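(* Let $\{\mathcal{Z}^k\}_{k\ge 0}$, $\mathcal{Z}^k=(\mathcal{S}^k,[\boldsymbol{X}_1^k],[\boldsymbol{X}_2^k],[\boldsymbol{X}_3^k],[\mathcal{G}^k],\mathcal{L}^k)$, be the sequence generated by the P-BCD algorithm described in the context. Then every accumulation point of $\{\mathcal{Z}^k\}$ is a first-order stationary point (in the sense defined in the context) of the problem $$\min\ \Phi(\mathcal{S},[\boldsymbol{X}_1],[\boldsymbol{X}_2],[\boldsymbol{X}_3],[\mathcal{G}],\mathcal{L})\quad\text{s.t. } [\boldsymbol{X}_i]^\top[\boldsymbol{X}_i]=[\boldsymbol{I}_{n_i}],\ i=1,2,3.$$
   Context: Notation. $\|\cdot\|_F$ is the Frobenius norm (square root of the sum of squares of all entries) of a matrix or tensor of any order. For a third order tensor $\mathcal{X}$, $\boldsymbol{X}_{(i)}$ denotes its mode-$i$ unfolding (rows indexed by the $i$-th index, columns by the remaining two indices in a fixed order), and for a matrix $\boldsymbol{X}$ of compatible size $\mathcal{Y}=\mathcal{G}\times_i\boldsymbol{X}$ is the tensor with $\boldsymbol{Y}_{(i)}=\boldsymbol{X}\boldsymbol{G}_{(i)}$. Brackets $[\,\cdot\,]$ denote a stack of $N$ independent objects: $[\mathcal{G}]\in\mathbb{R}^{n_1\times n_2\times n_3\times N}$ has $j$-th member $[\mathcal{G}]^{(j)}\in\mathbb{R}^{n_1\times n_2\times n_3}$, $[\boldsymbol{X}_i]\in\mathbb{R}^{m_i\times n_i\times N}$ has $j$-th member $[\boldsymbol{X}_i]^{(j)}\in\mathbb{R}^{m_i\times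 n_i}$, and all operations on stacks (products, transposes, $\times_i$, and the unfolding, written $[\cdot]_{[(i)]}$) are performed separately for each $j=1,\dots,N$. $[\boldsymbol{I}_n]$ is the stack of $N$ copies of the identity $\boldsymbol{I}_n$. For $m\ge n$, $\mathbb{S}_{m,n}=\{\boldsymbol{X}\in\mathbb{R}^{m\times n}:\boldsymbol{X}^\top\boldsymbol{X}=\boldsymbol{I}_n\}$, and $[\boldsymbol{X}]\in[\mathbb{S}_{m,n}]$ means $[\boldsymbol{X}]^{(j)}\in\mathbb{S}_{m,n}$ for all $j$. Data. $\mathcal{D}\in\mathbb{R}^{I_1\times I_2\times I_3}$ is given; $m_i\ge n_i$ for $i=1,2,3$; $p\in(0,1)$; $\gamma,\delta>0$; $\boldsymbol{w}\in\mathbb{R}^N$ has positive entries. $\mathscr{R}:\mathbb{R}^{I_1\times I_2\times I_3}\to\mathbb{R}^{m_1\times m_2\times m_3\times N}$ is a block extraction operator, a linear map with transpose (adjoint) $\mathscr{R}^\top$ satisfying $\mathscr{R}^\top\mathscr{R}(\mathcal{L})=\mathcal{W}_{\mathscr{R}}\odot\mathcal{L}$ for all $\mathcal{L}$, where $\odot$ is the component-wise product and $\mathcal{W}_{\mathscr{R}}\in\mathbb{R}^{I_1\times I_2\times I_3}$ has all entries positive. Objective. $\varphi(\mathcal{S})=\|\mathcal{S}\|_{2,p}^p=\sum_{i_3=1}^{I_3}\sum_{i_2=1}^{I_2}\big(\sum_{i_1=1}^{I_1}s_{i_1i_2i_3}^2\big)^{p/2}$; $\psi([\mathcal{G}])=\sum_{j=1}^N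 w_j\|[\mathcal{G}]^{(j)}\|_1$, where $\|\cdot\|_1$ is the sum of absolute values of the entries; $$H([\boldsymbol{X}_1],[\boldsymbol{X}_2],[\boldsymbol{X}_3],[\mathcal{G}],\mathcal{L})=\tfrac12\|\mathscr{R}(\mathcal{L})-[\mathcal{G}]\times_1[\boldsymbol{X}_1]\times_2[\boldsymbol{X}_2]\times_3[\boldsymbol{X}_3]\|_F^2;$$ $$\Phi(\mathcal{S},[\boldsymbol{X}_1],[\boldsymbol{X}_2],[\boldsymbol{X}_3],[\mathcal{G}],\mathcal{L})=\tfrac12\|\mathcal{L}+\mathcal{S}-\mathcal{D}\|_F^2+\gamma\varphi(\mathcal{S})+\psi([\mathcal{G}])+\delta H([\boldsymbol{X}_1],[\boldsymbol{X}_2],[\boldsymbol{X}_3],[\mathcal{G}],\mathcal{L}).$$ P-BCD algorithm. Fix $\alpha_{\mathcal{S}},\alpha_{\boldsymbol{X}},\alpha_{\mathcal{G}}>0$ and an initial point $\mathcal{Z}^0=(\mathcal{S}^0,[\boldsymbol{X}_1^0],[\boldsymbol{X}_2^0],[\boldsymbol{X}_3^0],[\mathcal{G}^0],\mathcal{L}^0)$ with $[\boldsymbol{X}_i^0]\in[\mathbb{S}_{m_i,n_i}]$. For $k=0,1,2,\dots$ (without stopping): $$\mathcal{S}^{k+1}\in\arg\min_{\mathcal{S}}\Phi(\mathcal{S},[\boldsymbol{X}_1^k],[\boldsymbol{X}_2^k],[\boldsymbol{X}_3^k],[\mathcal{G}^k],\mathcal{L}^k)+\tfrac{\alpha_{\mathcal{S}}}{2}\|\mathcal{S}-\mathcal{S}^k\|_F^2,$$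 $$[\boldsymbol{X}_1^{k+1}]\in\arg\min_{[\boldsymbol{X}_1]\in[\mathbb{S}_{m_1,n_1}]}\Phi(\mathcal{S}^{k+1},[\boldsymbol{X}_1],[\boldsymbol{X}_2^k],[\boldsymbol{X}_3^k],[\mathcal{G}^k],\mathcal{L}^k)+\tfrac{\alpha_{\boldsymbol{X}}}{2}\|[\boldsymbol{X}_1]-[\boldsymbol{X}_1^k]\|_F^2,$$ $$[\boldsymbol{X}_2^{k+1}]\in\arg\min_{[\boldsymbol{X}_2]\in[\mathbb{S}_{m_2,n_2}]}\Phi(\mathcal{S}^{k+1},[\boldsymbol{X}_1^{k+1}],[\boldsymbol{X}_2],[\boldsymbol{X}_3^k],[\mathcal{G}^k],\mathcal{L}^k)+\tfrac{\alpha_{\boldsymbol{X}}}{2}\|[\boldsymbol{X}_2]-[\boldsymbol{X}_2^k]\|_F^2,$$ $$[\boldsymbol{X}_3^{k+1}]\in\arg\min_{[\boldsymbol{X}_3]\in[\mathbb{S}_{m_3,n_3}]}\Phi(\mathcal{S}^{k+1},[\boldsymbol{X}_1^{k+1}],[\boldsymbol{X}_2^{k+1}],[\boldsymbol{X}_3],[\mathcal{G}^k],\mathcal{L}^k)+\tfrac{\alpha_{\boldsymbol{X}}}{2}\|[\boldsymbol{X}_3]-[\boldsymbol{X}_3^k]\|_F^2,$$ $$[\mathcal{G}^{k+1}]=\arg\min_{[\mathcal{G}]}\Phi(\mathcal{S}^{k+1},[\boldsymbol{X}_1^{k+1}],[\boldsymbol{X}_2^{k+1}],[\boldsymbol{X}_3^{k+1}],[\mathcal{G}],\mathcal{L}^k)+\tfrac{\alpha_{\mathcal{G}}}{2}\|[\mathcal{G}]-[\mathcal{G}^k]\|_F^2,$$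 $$\mathcal{L}^{k+1}=\arg\min_{\mathcal{L}}\Phi(\mathcal{S}^{k+1},[\boldsymbol{X}_1^{k+1}],[\boldsymbol{X}_2^{k+1}],[\boldsymbol{X}_3^{k+1}],[\mathcal{G}^{k+1}],\mathcal{L}).$$ Whenever a minimizer is not unique, an arbitrary one is selected. Subdifferential. For a proper lower semicontinuous $f:\mathbb{R}^d\to(-\infty,+\infty]$ with finite lower bound and $\boldsymbol{x}\in\operatorname{dom}f$, the Fréchet subdifferential $\hat\partial f(\boldsymbol{x})$ is the set of $\boldsymbol{u}$ with $\liminf_{\boldsymbol{y}\to\boldsymbol{x},\,\boldsymbol{y}\ne\boldsymbol{x}}\frac{f(\boldsymbol{y})-f(\boldsymbol{x})-\langle\boldsymbol{u},\boldsymbol{y}-\boldsymbol{x}\rangle}{\|\boldsymbol{y}-\boldsymbol{x}\|}\ge0$, and the (limiting) subdifferential $\partial f(\boldsymbol{x})$ is the set of $\boldsymbol{u}$ for which there exist $\boldsymbol{x}^k\to\boldsymbol{x}$ with $f(\boldsymbol{x}^k)\to f(\boldsymbol{x})$ and $\boldsymbol{u}^k\in\hat\partial f(\boldsymbol{x}^k)$ with $\boldsymbol{u}^k\to\boldsymbol{u}$. First-order stationary point. A point $\bar{\mathcal{Z}}=(\bar{\mathcal{S}},[\bar{\boldsymbol{X}}_1],[\bar{\boldsymbol{X}}_2],[\bar{\boldsymbol{X}}_3],[\bar{\mathcal{G}}],\bar{\mathcal{L}})$ is a first-order stationary point of the problem if, for $i=1,2,3$, (a) $\boldsymbol{0}\in\bar{\mathcal{L}}+\bar{\mathcal{S}}-\mathcal{D}+\gamma\,\partial\varphi(\bar{\mathcal{S}})$;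 (b) $\boldsymbol{0}=([\boldsymbol{I}_{m_i}]-[\bar{\boldsymbol{X}}_i][\bar{\boldsymbol{X}}_i]^\top)[\bar{\boldsymbol{H}}_i]$ (substationarity); (c) $\boldsymbol{0}=[\bar{\boldsymbol{H}}_i]^\top[\bar{\boldsymbol{X}}_i]-[\bar{\boldsymbol{X}}_i]^\top[\bar{\boldsymbol{H}}_i]$ (symmetry); (d) $[\bar{\boldsymbol{X}}_i]^\top[\bar{\boldsymbol{X}}_i]=[\boldsymbol{I}_{n_i}]$ (feasibility); (e) $\boldsymbol{0}\in\delta([\bar{\mathcal{G}}]-[\bar{\mathcal{O}}])+\partial\psi([\bar{\mathcal{G}}])$; (f) $\boldsymbol{0}=\bar{\mathcal{L}}+\bar{\mathcal{S}}-\mathcal{D}+\delta\,\mathcal{W}_{\mathscr{R}}\odot\bar{\mathcal{L}}-\delta\,\mathscr{R}^\top([\bar{\mathcal{Y}}])$; where $[\bar{\boldsymbol{P}}_i]=(\mathscr{R}(\bar{\mathcal{L}}))_{[(i)]}$, $[\bar{\boldsymbol{Q}}_1]=([\bar{\mathcal{G}}]\times_2[\bar{\boldsymbol{X}}_2]\times_3[\bar{\boldsymbol{X}}_3])_{[(1)]}$, $[\bar{\boldsymbol{Q}}_2]=([\bar{\mathcal{G}}]\times_1[\bar{\boldsymbol{X}}_1]\times_3[\bar{\boldsymbol{X}}_3])_{[(2)]}$, $[\bar{\boldsymbol{Q}}_3]=([\bar{\mathcal{G}}]\times_1[\bar{\boldsymbol{X}}_1]\times_2[\bar{\boldsymbol{X}}_2])_{[(3)]}$,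 $[\bar{\boldsymbol{H}}_i]=([\bar{\boldsymbol{X}}_i][\bar{\boldsymbol{Q}}_i]-[\bar{\boldsymbol{P}}_i])[\bar{\boldsymbol{Q}}_i]^\top$, $[\bar{\mathcal{O}}]=\mathscr{R}(\bar{\mathcal{L}})\times_1[\bar{\boldsymbol{X}}_1]^\top\times_2[\bar{\boldsymbol{X}}_2]^\top\times_3[\bar{\boldsymbol{X}}_3]^\top$, $[\bar{\mathcal{Y}}]=[\bar{\mathcal{G}}]\times_1[\bar{\boldsymbol{X}}_1]\times_2[\bar{\boldsymbol{X}}_2]\times_3[\bar{\boldsymbol{X}}_3]$. *)

(* Defs.v *)
From HB Require Import structures.
From mathcomp Require Import all_boot all_order all_algebra.
From mathcomp Require Import all_classical all_reals all_analysis.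

Set Implicit Arguments.
Unset Strict Implicit.
Unset Printing Implicit Defensive.

Import Order.TTheory GRing.Theory Num.Theory.
Import numFieldNormedType.Exports.

Local Open Scope classical_set_scope.
Local Open Scope ring_scope.

(* Every space of arrays is a Euclidean space [{ffun I -> R}] with [I] the
   finite set of multi-indices.  In a stack the last index is the member. *)
Notation tensor R n1 n2 n3 := {ffun 'I_n1 * 'I_n2 * 'I_n3 -> R}.
Notation tensor_stack R n1 n2 n3 N :=
  {ffun 'I_n1 * 'I_n2 * 'I_n3 * 'I_N -> R}.
Notation mx_stack R m n N := {ffun 'I_m * 'I_n * 'I_N -> R}.

Section Euclidean.
Context {R : realType} {I : finType}.
Implicit Types (x y u : {ffun I -> R}) (f : {ffun I -> R} -> \bar R).

Definition inner x y : R := \sum_i x i * y i.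

Definition frob_norm x : R := Num.sqrt (\sum_i x i ^+ 2).

Definition hadamard x y : {ffun I -> R} := [ffun i => x i * y i].

Definition tends_to (xs : nat -> {ffun I -> R}) x : Prop :=
  frob_norm (xs k - x) @[k --> \oo] --> (0 : R).

Definition punctured_ball x (e : R) : set {ffun I -> R} :=
  [set y | y != x /\ frob_norm (y - x) < e].

(* Lower limit of [g y] as [y] tends to [x] with [y != x]; it is [+oo] in the
   zero-dimensional space, where punctured balls are empty. *)
Definition liminf_at (g : {ffun I -> R} -> \bar R) x : \bar R :=
  ereal_sup [set ereal_inf [set g y | y in punctured_ball x e]
            | e in [set e : R | 0 < e]].

(* Both subdifferentials are empty outside the domain of [f]. *)
Definition frechet_subdiff f x : set {ffun I -> R} :=
  [set u | f x \is a fin_num /\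
    (0 <= liminf_at (fun y => (f y - f x - (inner u (y - x))%:E)
                              * ((frob_norm (y - x))^-1)%:E) x)%E].

Definition subdiff f x : set {ffun I -> R} :=
  [set u | f x \is a fin_num /\
    exists xs us : nat -> {ffun I -> R},
      [/\ tends_to xs x,
          f (xs k) @[k --> \oo] --> f x,
          forall k, frechet_subdiff f (xs k) (us k)
        & tends_to us u]].

End Euclidean.

Definition argmin {R : realType} {T : Type} (A : set T) (f : T -> R) : set T :=
  [set x | A x /\ forall y, A y -> f x <= f y].

Section Unfolding.
Context {R : realType} {n1 n2 n3 : nat}.
Implicit Type G : tensor R n1 n2 n3.

(* Row [i] of an unfolding is the row-major vectorization of the [i]-th slice
   of the tensor in that mode. *)
Definition unfold1 G : 'M[R]_(n1, n2 * n3) :=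
  \matrix_(i, c) mxvec (\matrix_(j, k) G (i, j, k)) 0 c.
Definition unfold2 G : 'M[R]_(n2, n1 * n3) :=
  \matrix_(j, c) mxvec (\matrix_(i, k) G (i, j, k)) 0 c.
Definition unfold3 G : 'M[R]_(n3, n1 * n2) :=
  \matrix_(k, c) mxvec (\matrix_(i, j) G (i, j, k)) 0 c.

Definition fold1 (M : 'M[R]_(n1, n2 * n3)) : tensor R n1 n2 n3 :=
  [ffun t => M t.1.1 (mxvec_index t.1.2 t.2)].
Definition fold2 (M : 'M[R]_(n2, n1 * n3)) : tensor R n1 n2 n3 :=
  [ffun t => M t.1.2 (mxvec_index t.1.1 t.2)].
Definition fold3 (M : 'M[R]_(n3, n1 * n2)) : tensor R n1 n2 n3 :=
  [ffun t => M t.2 (mxvec_index t.1.1 t.1.2)].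

Lemma fold1K : cancel fold1 unfold1.
Proof.
move=> M; apply/matrixP => i c; rewrite !mxE.
by case/mxvec_indexP: c => j k; rewrite mxvecE !mxE ffunE.
Qed.

Lemma fold2K : cancel fold2 unfold2.
Proof.
move=> M; apply/matrixP => i c; rewrite !mxE.
by case/mxvec_indexP: c => j k; rewrite mxvecE !mxE ffunE.
Qed.

Lemma fold3K : cancel fold3 unfold3.
Proof.
move=> M; apply/matrixP => i c; rewrite !mxE.
by case/mxvec_indexP: c => j k; rewrite mxvecE !mxE ffunE.
Qed.

End Unfolding.

Section ModeProduct.
Context {R : realType} {n1 n2 n3 : nat}.
Implicit Type G : tensor R n1 n2 n3.

Definition mode_prod1 {m} G (X : 'M[R]_(m, n1)) : tensor R m n2 n3 :=
  fold1 (X *m unfold1 G).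
Definition mode_prod2 {m} G (X : 'M[R]_(m, n2)) : tensor R n1 m n3 :=
  fold2 (X *m unfold2 G).
Definition mode_prod3 {m} G (X : 'M[R]_(m, n3)) : tensor R n1 n2 m :=
  fold3 (X *m unfold3 G).

End ModeProduct.

Notation "G ×1 X" := (mode_prod1 G X)
  (at level 40, left associativity) : ring_scope.
Notation "G ×2 X" := (mode_prod2 G X)
  (at level 40, left associativity) : ring_scope.
Notation "G ×3 X" := (mode_prod3 G X)
  (at level 40, left associativity) : ring_scope.

Section Stacks.
Context {R : realType} {N : nat}.

Definition tmember {n1 n2 n3} (G : tensor_stack R n1 n2 n3 N) (j : 'I_N) :
  tensor R n1 n2 n3 := [ffun t => G (t, j)].

Definition tstack {n1 n2 n3} (F : 'I_N -> tensor R n1 n2 n3) :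
  tensor_stack R n1 n2 n3 N := [ffun q => F q.2 q.1].

Definition mxmember {m n} (X : mx_stack R m n N) (j : 'I_N) : 'M[R]_(m, n) :=
  \matrix_(i, k) X (i, k, j).

Definition stiefel m n : set 'M[R]_(m, n) := [set X | X^T *m X = 1%:M].

Definition stiefel_stack m n : set (mx_stack R m n N) :=
  [set X | forall j, stiefel (mxmember X j)].

Definition tucker {m1 m2 m3 n1 n2 n3} (X1 : mx_stack R m1 n1 N)
    (X2 : mx_stack R m2 n2 N) (X3 : mx_stack R m3 n3 N)
    (G : tensor_stack R n1 n2 n3 N) : tensor_stack R m1 m2 m3 N :=
  tstack (fun j =>
    tmember G j ×1 mxmember X1 j ×2 mxmember X2 j ×3 mxmember X3 j).

End Stacks.

Definition is_adjoint {R : realType} {I J : finType}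
    (A : {ffun I -> R} -> {ffun J -> R}) (At : {ffun J -> R} -> {ffun I -> R}) :=
  forall x y, inner (A x) y = inner x (At y).

Section Problem.
Context {R : realType} {I1 I2 I3 m1 m2 m3 n1 n2 n3 N : nat}.
Variables (D : tensor R I1 I2 I3) (p gamma delta : R) (w : 'I_N -> R).
Variables (Rop : {linear tensor R I1 I2 I3 -> tensor_stack R m1 m2 m3 N})
          (RopT : tensor_stack R m1 m2 m3 N -> tensor R I1 I2 I3)
          (W : tensor R I1 I2 I3).

Definition phi (S : tensor R I1 I2 I3) : R :=
  \sum_(i3 < I3) \sum_(i2 < I2)
    (\sum_(i1 < I1) S (i1, i2, i3) ^+ 2) `^ (p / 2).

Definition psi (G : tensor_stack R n1 n2 n3 N) : R :=
  \sum_(j < N) w j * \sum_t `|tmember G j t|.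

Definition Hfun (X1 : mx_stack R m1 n1 N) (X2 : mx_stack R m2 n2 N)
    (X3 : mx_stack R m3 n3 N) (G : tensor_stack R n1 n2 n3 N)
    (L : tensor R I1 I2 I3) : R :=
  2^-1 * frob_norm (Rop L - tucker X1 X2 X3 G) ^+ 2.

Definition Phi (S : tensor R I1 I2 I3) (X1 : mx_stack R m1 n1 N)
    (X2 : mx_stack R m2 n2 N) (X3 : mx_stack R m3 n3 N)
    (G : tensor_stack R n1 n2 n3 N) (L : tensor R I1 I2 I3) : R :=
  2^-1 * frob_norm (L + S - D) ^+ 2 + gamma * phi S + psi G
  + delta * Hfun X1 X2 X3 G L.

Record iterate := Iterate {
  ptS : tensor R I1 I2 I3;
  ptX1 : mx_stack R m1 n1 N;
  ptX2 : mx_stack R m2 n2 N;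
  ptX3 : mx_stack R m3 n3 N;
  ptG : tensor_stack R n1 n2 n3 N;
  ptL : tensor R I1 I2 I3 }.

Definition pbcd_step (alphaS alphaX alphaG : R) (Z Z' : iterate) : Prop :=
  let: Iterate S0 X1 X2 X3 G L := Z in
  let: Iterate S' X1' X2' X3' G' L' := Z' in
  [/\ argmin setT (fun Y => Phi Y X1 X2 X3 G L
        + alphaS / 2 * frob_norm (Y - S0) ^+ 2) S',
      argmin (@stiefel_stack R N m1 n1) (fun Y => Phi S' Y X2 X3 G L
        + alphaX / 2 * frob_norm (Y - X1) ^+ 2) X1',
      argmin (@stiefel_stack R N m2 n2) (fun Y => Phi S' X1' Y X3 G L
        + alphaX / 2 * frob_norm (Y - X2) ^+ 2) X2',
      argmin (@stiefel_stack R N m3 n3) (fun Y => Phi S' X1' X2' Y G L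
        + alphaX / 2 * frob_norm (Y - X3) ^+ 2) X3'
    & argmin setT (fun Y => Phi S' X1' X2' X3' Y L
        + alphaG / 2 * frob_norm (Y - G) ^+ 2) G'
      /\ argmin setT (fun Y => Phi S' X1' X2' X3' G' Y) L'].

Definition pbcd_sequence (alphaS alphaX alphaG : R)
    (Z : nat -> iterate) : Prop :=
  [/\ stiefel_stack (ptX1 (Z 0%N)),
      stiefel_stack (ptX2 (Z 0%N)),
      stiefel_stack (ptX3 (Z 0%N))
    & forall k, pbcd_step alphaS alphaX alphaG (Z k) (Z k.+1)].

Definition iterate_tends_to (Z : nat -> iterate) (Zb : iterate) : Prop :=
  [/\ tends_to (ptS \o Z) (ptS Zb),
      tends_to (ptX1 \o Z) (ptX1 Zb),
      tends_to (ptX2 \o Z) (ptX2 Zb),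
      tends_to (ptX3 \o Z) (ptX3 Zb)
    & tends_to (ptG \o Z) (ptG Zb) /\ tends_to (ptL \o Z) (ptL Zb)].

Definition accumulation_point (Z : nat -> iterate) (Zb : iterate) : Prop :=
  exists s : nat -> nat,
    {homo s : k l / (k < l)%N} /\ iterate_tends_to (Z \o s) Zb.

(* Substationarity, symmetry and feasibility, member by member. *)
Definition factor_stationary {m n d} (X : mx_stack R m n N)
    (P : 'I_N -> 'M[R]_(m, d)) (Q : 'I_N -> 'M[R]_(n, d)) : Prop :=
  let H j := (mxmember X j *m Q j - P j) *m (Q j)^T in
  [/\ forall j, (1%:M - mxmember X j *m (mxmember X j)^T) *m H j = 0,
      forall j, (H j)^T *m mxmember X j - (mxmember X j)^T *m H j = 0
    & stiefel_stack X].

Definition stationary_point (Z : iterate) : Prop :=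
  let: Iterate S0 X1 X2 X3 G L := Z in
  let P j := tmember (Rop L) j in
  let Q1 j := unfold1 (tmember G j ×2 mxmember X2 j ×3 mxmember X3 j) in
  let Q2 j := unfold2 (tmember G j ×1 mxmember X1 j ×3 mxmember X3 j) in
  let Q3 j := unfold3 (tmember G j ×1 mxmember X1 j ×2 mxmember X2 j) in
  let O_ := tstack (fun j => P j ×1 (mxmember X1 j)^T
                                 ×2 (mxmember X2 j)^T ×3 (mxmember X3 j)^T) in
  [/\ exists2 u, subdiff (EFin \o phi) S0 u & 0 = L + S0 - D + gamma *: u,
      [/\ factor_stationary X1 (unfold1 \o P) Q1,
          factor_stationary X2 (unfold2 \o P) Q2
        & factor_stationary X3 (unfold3 \o P) Q3],
      exists2 v, subdiff (EFin \o psi) G v & 0 = delta *: (G - O_) + v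
    & 0 = L + S0 - D + delta *: hadamard W L
          - delta *: RopT (tucker X1 X2 X3 G)].

End Problem.
Arguments iterate R I1 I2 I3 m1 m2 m3 n1 n2 n3 N : clear implicits.

(* Main.v *)
(** The proximal terms make the objective decrease by at least a multiple of the
    squared increments of S, X_i and G; being nonnegative, the objective
    converges along the iterates and these increments tend to 0. Hence along a
    subsequence converging to an accumulation point, the next iterates have the
    same limit in S, X_i and G, and by continuity of the objective every
    subproblem passes to the limit: the accumulation point is a fixed point of
    the algorithm. At a fixed point, comparing with nearby S or G gives a
    quadratic minorant, so a Frechet subgradient (tucker with orthonormal
    factors is an isometry, which makes the G-block explicit); L is an
    unconstrained quadratic minimum; and each factor maximizes a linear form
    tr(M X^T) over the Stiefel manifold, since the quadratic terms are constant
    there. Rotating in coordinate planes shows that X M^T is symmetric, which is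
    equivalent to the two Stiefel stationarity conditions. *)
Require Import Defs.
From mathcomp Require Import all_boot all_order all_algebra.
From mathcomp Require Import all_classical all_reals all_analysis.
From mathcomp Require Import ring lra.
Set Implicit Arguments.
Unset Strict Implicit.
Unset Printing Implicit Defensive.
Import Order.TTheory GRing.Theory Num.Theory.
Import numFieldNormedType.Exports.
Local Open Scope classical_set_scope.
Local Open Scope ring_scope.

(** For small [t] of sign opposite to [b] the linear term would dominate and make the expression
    negative. The choice [t = - b / (|K| + 1)] works whatever the sign of [K]. *)
Lemma linear_coef_eq0 (R : realType) (b K : R) :
  (forall t, 0 <= t * b + t ^+ 2 * K) -> b = 0.
Proof.
move=> H; apply/eqP; case: (eqVneq b 0) => // b0; exfalso.
have K1 : 0 < `|K| + 1 by rewrite ltr_wpDl.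
have := H (- b / (`|K| + 1)); rewrite leNgt => /negP; apply.
have -> : - b / (`|K| + 1) * b + (- b / (`|K| + 1)) ^+ 2 * K =
   - ((b / (`|K| + 1)) ^+ 2 * (`|K| + 1 - K)) by field; rewrite gt_eqF.
rewrite oppr_lt0 mulr_gt0//.
  by rewrite exprn_even_gt0//= mulf_neq0// invr_neq0// gt_eqF.
by rewrite subr_gt0 (le_lt_trans (ler_norm _))// ltrDl.
Qed.

(** * Inner product, Frobenius norm and Frechet subgradients *)

Section EuclideanSpace.
Context {R : realType} {I : finType}.
Implicit Types (x y z u : {ffun I -> R}).

Lemma frob_sqE x : frob_norm x ^+ 2 = inner x x.
Proof.
rewrite /frob_norm sqr_sqrtr; last by apply: sumr_ge0 => i _; rewrite sqr_ge0.
by apply: eq_bigr => i _; rewrite expr2.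
Qed.

Lemma innerC x y : inner x y = inner y x.
Proof. by apply: eq_bigr => i _; rewrite mulrC. Qed.

Lemma innerDl x y z : inner (x + y) z = inner x z + inner y z.
Proof. by rewrite -big_split; apply: eq_bigr => i _; rewrite ffunE mulrDl. Qed.

Lemma innerZl a x z : inner (a *: x) z = a * inner x z.
Proof. by rewrite mulr_sumr; apply: eq_bigr => i _; rewrite ffunE mulrA. Qed.

Lemma innerNl x z : inner (- x) z = - inner x z.
Proof. by rewrite -scaleN1r innerZl mulN1r. Qed.

Lemma innerDr x y z : inner z (x + y) = inner z x + inner z y.
Proof. by rewrite innerC innerDl !(innerC z). Qed.

Lemma innerZr a x z : inner z (a *: x) = a * inner z x.
Proof. by rewrite innerC innerZl (innerC z). Qed.

Lemma innerNr x z : inner z (- x) = - inner z x.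
Proof. by rewrite innerC innerNl (innerC z). Qed.

Lemma frob_sqD x y :
  frob_norm (x + y) ^+ 2 = frob_norm x ^+ 2 + 2 * inner x y + frob_norm y ^+ 2.
Proof. by rewrite !frob_sqE !innerDl !innerDr (innerC y x); ring. Qed.

Lemma innerBl x y z : inner (x - y) z = inner x z - inner y z.
Proof. by rewrite innerDl innerNl. Qed.

Lemma frob_sqB x y :
  frob_norm (x - y) ^+ 2 = frob_norm x ^+ 2 - 2 * inner x y + frob_norm y ^+ 2.
Proof.
rewrite frob_sqD innerNr mulrN; congr (_ + _).
by rewrite !frob_sqE innerNl innerNr opprK.
Qed.

Lemma frob_sqBD x y z : frob_norm (x - (y + z)) ^+ 2 =
  frob_norm (x - y) ^+ 2 - 2 * (inner x z - inner y z) + frob_norm z ^+ 2.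
Proof. by rewrite opprD addrA (frob_sqB (x - y)) innerBl. Qed.

Lemma frob_norm_ge0 x : 0 <= frob_norm x.
Proof. exact: sqrtr_ge0. Qed.

Lemma inner_eq0 x : inner x x = 0 -> x = 0.
Proof.
move=> /eqP; rewrite psumr_eq0; last by move=> i _; rewrite -expr2 sqr_ge0.
move=> /allP H; apply/ffunP => i; rewrite ffunE; apply/eqP.
by have := H i (mem_index_enum _); rewrite mulf_eq0 orbb.
Qed.

Lemma frob_norm0 : frob_norm (0 : {ffun I -> R}) = 0.
Proof.
by rewrite /frob_norm big1 ?sqrtr0// => i _; rewrite ffunE expr0n.
Qed.

Lemma frob_norm_eq0 x : frob_norm x = 0 -> x = 0.
Proof. by move=> x0; apply: inner_eq0; rewrite -frob_sqE x0 expr0n. Qed.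

Lemma le_entry_frob x i : `|x i| <= frob_norm x.
Proof.
rewrite -sqrtr_sqr /frob_norm ler_sqrt; last first.
  by apply: sumr_ge0 => j _; rewrite sqr_ge0.
rewrite (bigD1 i)//= lerDl; apply: sumr_ge0 => j _; exact: sqr_ge0.
Qed.

(** The difference quotient is at least [- C * frob_norm (y - x)], which vanishes as [y] tends to
    [x]. This turns minimality in a proximal subproblem into a subgradient, with no appeal to
    convexity. *)
Lemma quadratic_minorant_frechet_subdiff (f : {ffun I -> R} -> R) x u (C : R) :
  0 <= C ->
  (forall y, inner u (y - x) - C * frob_norm (y - x) ^+ 2 <= f y - f x) ->
  frechet_subdiff (EFin \o f) x u.
Proof.
move=> C0 H; split => //; apply/lee_subgt0Pr => e e0.
(* On the ball of this radius the quotient is at least [- e]; the [+ 1] covers [C = 0]. *)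
have eC : 0 < e / (C + 1) by rewrite divr_gt0// ltr_wpDl.
apply: le_ereal_sup_tmp; exists (ereal_inf [set
  (((EFin \o f) y - (EFin \o f) x - (inner u (y - x))%:E) *
     ((frob_norm (y - x))^-1)%:E)%E | y in punctured_ball x (e / (C + 1))]).
  by exists (e / (C + 1)).
apply: le_ereal_inf_tmp => _ [y [yx ye] <-] /=.
rewrite -!EFinB -EFinM lee_fin sub0r.
have d0 : 0 < frob_norm (y - x).
  rewrite lt_neqAle frob_norm_ge0 andbT eq_sym; apply: contra yx => /eqP.
  by move=> /frob_norm_eq0 /eqP; rewrite subr_eq0.
rewrite ler_pdivlMr//.
have := H y; set d := frob_norm _ in d0 ye *.
have h : C * d <= e.
  rewrite (le_trans (ler_wpM2l C0 (ltW ye)))//.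
  by rewrite mulrCA ler_piMr ?(ltW e0)// ler_pdivrMr ?ltr_wpDl// mul1r lerDl.
by have := ler_wpM2r (ltW d0) h; lra.
Qed.

End EuclideanSpace.

(** * Mode products and unfoldings of third-order tensors *)

Section ModeProducts.
Context {R : realType}.

Lemma trace_gram m n (A B : 'M[R]_(m, n)) :
  \tr (A *m B^T) = \sum_i \sum_c A i c * B i c.
Proof.
by apply: eq_bigr => i _; rewrite mxE; apply: eq_bigr => c _; rewrite mxE.
Qed.

Lemma sum_mxvec_index m n (F : 'I_(m * n) -> R) :
  \sum_c F c = \sum_i \sum_j F (mxvec_index i j).
Proof.
rewrite pair_big (reindex _ (curry_mxvec_bij _ _)) /=.
by apply: eq_bigr => -[].
Qed.

Section Unfold.
Context {n1 n2 n3 : nat}.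
Implicit Types G H : tensor R n1 n2 n3.

Lemma inner_sum3 G H : inner G H =
  \sum_i \sum_j \sum_k G (i, j, k) * H (i, j, k).
Proof. by rewrite /inner !pair_big; apply: eq_bigr => -[[]]. Qed.

(** Unfolding only rearranges entries. The trace form opens mode products to matrix algebra and
    cyclicity of the trace. *)
Lemma inner_unfold1 G H : inner G H = \tr (unfold1 G *m (unfold1 H)^T).
Proof.
rewrite trace_gram inner_sum3; apply: eq_bigr => i _.
rewrite sum_mxvec_index; apply: eq_bigr => j _; apply: eq_bigr => k _.
by rewrite !mxE !mxvecE !mxE.
Qed.

Lemma inner_unfold2 G H : inner G H = \tr (unfold2 G *m (unfold2 H)^T).
Proof.
rewrite trace_gram inner_sum3 exchange_big; apply: eq_bigr => i _.
rewrite sum_mxvec_index; apply: eq_bigr => j _; apply: eq_bigr => k _.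
by rewrite !mxE !mxvecE !mxE.
Qed.

Lemma inner_unfold3 G H : inner G H = \tr (unfold3 G *m (unfold3 H)^T).
Proof.
rewrite trace_gram inner_sum3.
under eq_bigr do rewrite exchange_big.
rewrite exchange_big; apply: eq_bigr => i _.
rewrite sum_mxvec_index; apply: eq_bigr => j _; apply: eq_bigr => k _.
by rewrite !mxE !mxvecE !mxE.
Qed.

Lemma unfold1B G H : unfold1 (G - H) = unfold1 G - unfold1 H.
Proof.
apply/matrixP => i c; rewrite !mxE; case/mxvec_indexP: c => j k.
by rewrite !mxvecE !mxE !ffunE.
Qed.

Lemma unfold2B G H : unfold2 (G - H) = unfold2 G - unfold2 H.
Proof.
apply/matrixP => i c; rewrite !mxE; case/mxvec_indexP: c => j k.
by rewrite !mxvecE !mxE !ffunE.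
Qed.

Lemma unfold3B G H : unfold3 (G - H) = unfold3 G - unfold3 H.
Proof.
apply/matrixP => i c; rewrite !mxE; case/mxvec_indexP: c => j k.
by rewrite !mxvecE !mxE !ffunE.
Qed.

Lemma mode_prod1E m G (X : 'M[R]_(m, n1)) i j k :
  (G ×1 X) (i, j, k) = \sum_a X i a * G (a, j, k).
Proof.
rewrite ffunE mxE; apply: eq_bigr => a _.
by rewrite [unfold1 _ _ _]mxE mxvecE mxE.
Qed.

Lemma mode_prod2E m G (X : 'M[R]_(m, n2)) i j k :
  (G ×2 X) (i, j, k) = \sum_a X j a * G (i, a, k).
Proof.
rewrite ffunE mxE; apply: eq_bigr => a _.
by rewrite [unfold2 _ _ _]mxE mxvecE mxE.
Qed.

Lemma mode_prod3E m G (X : 'M[R]_(m, n3)) i j k :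
  (G ×3 X) (i, j, k) = \sum_a X k a * G (i, j, a).
Proof.
rewrite ffunE mxE; apply: eq_bigr => a _.
by rewrite [unfold3 _ _ _]mxE mxvecE mxE.
Qed.

Lemma mode_prod1D m G H (X : 'M[R]_(m, n1)) : (G + H) ×1 X = G ×1 X + H ×1 X.
Proof.
apply/ffunP => -[[i j] k]; rewrite [RHS]ffunE !mode_prod1E -big_split.
by apply: eq_bigr => a _; rewrite !ffunE mulrDr.
Qed.

Lemma mode_prod2D m G H (X : 'M[R]_(m, n2)) : (G + H) ×2 X = G ×2 X + H ×2 X.
Proof.
apply/ffunP => -[[i j] k]; rewrite [RHS]ffunE !mode_prod2E -big_split.
by apply: eq_bigr => a _; rewrite !ffunE mulrDr.
Qed.

Lemma mode_prod3D m G H (X : 'M[R]_(m, n3)) : (G + H) ×3 X = G ×3 X + H ×3 X.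
Proof.
apply/ffunP => -[[i j] k]; rewrite [RHS]ffunE !mode_prod3E -big_split.
by apply: eq_bigr => a _; rewrite !ffunE mulrDr.
Qed.

End Unfold.

Section Commutation.
Context {m1 m2 m3 n1 n2 n3 : nat}.
Variables (G : tensor R n1 n2 n3) (X1 : 'M[R]_(m1, n1))
  (X2 : 'M[R]_(m2, n2)) (X3 : 'M[R]_(m3, n3)).

(** Different modes act on different indices, so two finite sums are exchanged. Any mode can thus be
    moved to the last place, where unfolding along it cancels the [fold]. *)
Lemma mode_prod12C : G ×1 X1 ×2 X2 = G ×2 X2 ×1 X1.
Proof.
apply/ffunP => -[[i j] k]; rewrite mode_prod1E mode_prod2E.
under eq_bigr do rewrite mode_prod1E mulr_sumr.
under [RHS]eq_bigr do rewrite mode_prod2E mulr_sumr.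
rewrite exchange_big; apply: eq_bigr => a _; apply: eq_bigr => b _.
by rewrite mulrCA.
Qed.

Lemma mode_prod13C : G ×1 X1 ×3 X3 = G ×3 X3 ×1 X1.
Proof.
apply/ffunP => -[[i j] k]; rewrite mode_prod1E mode_prod3E.
under eq_bigr do rewrite mode_prod1E mulr_sumr.
under [RHS]eq_bigr do rewrite mode_prod3E mulr_sumr.
rewrite exchange_big; apply: eq_bigr => a _; apply: eq_bigr => b _.
by rewrite mulrCA.
Qed.

Lemma mode_prod23C : G ×2 X2 ×3 X3 = G ×3 X3 ×2 X2.
Proof.
apply/ffunP => -[[i j] k]; rewrite mode_prod2E mode_prod3E.
under eq_bigr do rewrite mode_prod2E mulr_sumr.
under [RHS]eq_bigr do rewrite mode_prod3E mulr_sumr.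
rewrite exchange_big; apply: eq_bigr => a _; apply: eq_bigr => b _.
by rewrite mulrCA.
Qed.

End Commutation.

Section Adjoint.
Context {n1 n2 n3 : nat}.
Implicit Types G H : tensor R n1 n2 n3.

Lemma mode_prod1_adjoint m G (X : 'M[R]_(m, n1)) (H : tensor R m n2 n3) :
  inner H (G ×1 X) = inner (H ×1 X^T) G.
Proof.
by rewrite !inner_unfold1 !fold1K trmx_mul mulmxA mxtrace_mulC mulmxA.
Qed.

Lemma mode_prod2_adjoint m G (X : 'M[R]_(m, n2)) (H : tensor R n1 m n3) :
  inner H (G ×2 X) = inner (H ×2 X^T) G.
Proof.
by rewrite !inner_unfold2 !fold2K trmx_mul mulmxA mxtrace_mulC mulmxA.
Qed.

Lemma mode_prod3_adjoint m G (X : 'M[R]_(m, n3)) (H : tensor R n1 n2 m) :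
  inner H (G ×3 X) = inner (H ×3 X^T) G.
Proof.
by rewrite !inner_unfold3 !fold3K trmx_mul mulmxA mxtrace_mulC mulmxA.
Qed.

(** Cyclicity of the trace brings [X^T] next to [X], where orthonormal columns give the identity. *)
Lemma mode_prod1_isometry m G H (X : 'M[R]_(m, n1)) :
  stiefel X -> inner (G ×1 X) (H ×1 X) = inner G H.
Proof.
move=> XX; rewrite !inner_unfold1 !fold1K trmx_mul mulmxA mxtrace_mulC.
by rewrite !mulmxA XX mul1mx.
Qed.

Lemma mode_prod2_isometry m G H (X : 'M[R]_(m, n2)) :
  stiefel X -> inner (G ×2 X) (H ×2 X) = inner G H.
Proof.
move=> XX; rewrite !inner_unfold2 !fold2K trmx_mul mulmxA mxtrace_mulC.
by rewrite !mulmxA XX mul1mx.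
Qed.

Lemma mode_prod3_isometry m G H (X : 'M[R]_(m, n3)) :
  stiefel X -> inner (G ×3 X) (H ×3 X) = inner G H.
Proof.
move=> XX; rewrite !inner_unfold3 !fold3K trmx_mul mulmxA mxtrace_mulC.
by rewrite !mulmxA XX mul1mx.
Qed.

End Adjoint.
End ModeProducts.

(** * Stacks and the Tucker map *)

Section Stacks.
Context {R : realType} {N : nat}.

Lemma tmemberK n1 n2 n3 (F : 'I_N -> tensor R n1 n2 n3) j :
  tmember (tstack F) j = F j.
Proof. by apply/ffunP => t; rewrite !ffunE. Qed.

Lemma tmemberD n1 n2 n3 (G H : tensor_stack R n1 n2 n3 N) j :
  tmember (G + H) j = tmember G j + tmember H j.
Proof. by apply/ffunP => t; rewrite !ffunE. Qed.

Lemma tmemberB n1 n2 n3 (G H : tensor_stack R n1 n2 n3 N) j :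
  tmember (G - H) j = tmember G j - tmember H j.
Proof. by apply/ffunP => t; rewrite !ffunE. Qed.

Lemma inner_tmember n1 n2 n3 (G H : tensor_stack R n1 n2 n3 N) :
  inner G H = \sum_j inner (tmember G j) (tmember H j).
Proof.
rewrite /inner exchange_big pair_big; apply: eq_bigr => -[t j] _.
by rewrite !ffunE.
Qed.

Lemma inner_mxmember m n (X Y : mx_stack R m n N) :
  inner X Y = \sum_j \tr (mxmember X j *m (mxmember Y j)^T).
Proof.
under eq_bigr do rewrite trace_gram.
rewrite /inner exchange_big; under eq_bigr do rewrite exchange_big.
rewrite !pair_big; apply: eq_bigr => -[[i k] j] _ /=.
by rewrite !mxE.
Qed.

Lemma mxmemberB m n (X Y : mx_stack R m n N) j :
  mxmember (X - Y) j = mxmember X j - mxmember Y j.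
Proof. by apply/matrixP => i k; rewrite !mxE !ffunE. Qed.

Context {m1 m2 m3 n1 n2 n3 : nat}.
Variables (X1 : mx_stack R m1 n1 N) (X2 : mx_stack R m2 n2 N)
  (X3 : mx_stack R m3 n3 N).
Implicit Types (G H : tensor_stack R n1 n2 n3 N).

Lemma tuckerD G H : tucker X1 X2 X3 (G + H) =
  tucker X1 X2 X3 G + tucker X1 X2 X3 H.
Proof.
apply/ffunP => -[t j]; rewrite [RHS]ffunE [LHS]ffunE tmemberD.
by rewrite mode_prod1D mode_prod2D mode_prod3D [LHS]ffunE; congr (_ + _);
  rewrite [RHS]ffunE.
Qed.

Lemma tucker_isometry G H :
  stiefel_stack X1 -> stiefel_stack X2 -> stiefel_stack X3 ->
  inner (tucker X1 X2 X3 G) (tucker X1 X2 X3 H) = inner G H.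
Proof.
move=> h1 h2 h3; rewrite !inner_tmember; apply: eq_bigr => j _.
by rewrite !tmemberK mode_prod3_isometry// mode_prod2_isometry//
  mode_prod1_isometry.
Qed.

Lemma tucker_adjoint (Y : tensor_stack R m1 m2 m3 N) G :
  inner Y (tucker X1 X2 X3 G) =
  inner (tstack (fun j => tmember Y j ×1 (mxmember X1 j)^T
    ×2 (mxmember X2 j)^T ×3 (mxmember X3 j)^T)) G.
Proof.
rewrite !inner_tmember; apply: eq_bigr => j _; rewrite !tmemberK.
rewrite mode_prod3_adjoint mode_prod2_adjoint mode_prod1_adjoint.
(* Taking adjoints mode by mode yields the transposed factors in the order 3, 2, 1; commutation
   restores 1, 2, 3. *)
by rewrite -mode_prod12C -mode_prod13C mode_prod23C.
Qed.

(** Orthonormal factors make the Tucker map an isometry, so the second-order term is the plain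
    squared norm of [H] and the gradient in the core is [2 (G - O)]. *)
Lemma frob_sq_tucker_residual (Y : tensor_stack R m1 m2 m3 N) G H
    (O := tstack (fun j => tmember Y j ×1 (mxmember X1 j)^T
      ×2 (mxmember X2 j)^T ×3 (mxmember X3 j)^T)) :
  stiefel_stack X1 -> stiefel_stack X2 -> stiefel_stack X3 ->
  frob_norm (Y - tucker X1 X2 X3 (G + H)) ^+ 2 =
  frob_norm (Y - tucker X1 X2 X3 G) ^+ 2
  - 2 * (inner O H - inner G H) + frob_norm H ^+ 2.
Proof.
move=> h1 h2 h3; have OH := tucker_adjoint Y H; rewrite -/O in OH.
have GH := tucker_isometry G H h1 h2 h3.
have HH := tucker_isometry H H h1 h2 h3; rewrite -!frob_sqE in HH.
by rewrite -OH -GH -HH tuckerD; exact: frob_sqBD.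
Qed.

End Stacks.

(** * First-order conditions on the Stiefel manifold *)

Section Stiefel.
Context {R : realType}.

Lemma trace_delta_mul m (a b : 'I_m) (B : 'M[R]_m) :
  \tr (delta_mx a b *m B) = B b a.
Proof.
rewrite /mxtrace (bigD1 a)//= big1 ?addr0.
  rewrite mxE (bigD1 b)//= big1 ?addr0 => [|k kb].
    by rewrite mxE !eqxx mul1r.
  by rewrite mxE (negbTE kb) andbF mul0r.
move=> i ia; rewrite mxE big1// => k _.
by rewrite mxE (negbTE ia) mul0r.
Qed.

(** Rotating in the plane of the coordinates [a] and [b] changes the trace at a rate proportional to
    [B a b - B b a]; maximality at the identity forces this rate to vanish. *)
Lemma orthogonal_trace_max_sym m (B : 'M[R]_m) :
  (forall U : 'M[R]_m, U^T *m U = 1%:M -> \tr (U *m B) <= \tr B) ->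
  B^T = B.
Proof.
move=> maxB; apply/matrixP => a b; rewrite mxE.
case: (eqVneq a b) => [->//|ab].
(* [E] is the projection onto the plane of the two coordinates and [J] a quarter turn in it, so
   rotations of that plane have the form [1 + c E + s J]. *)
pose E : 'M[R]_m := delta_mx a a + delta_mx b b.
pose J : 'M[R]_m := delta_mx a b - delta_mx b a.
have ba := ab; rewrite eq_sym in ba.
have mul_delta (i j k l : 'I_m) :
    delta_mx i j *m delta_mx k l = delta_mx i l *+ (j == k) :> 'M[R]_m.
  exact: mul_delta_mx_cond.
have EE : E *m E = E by rewrite /E !(mulmxDl, mulmxDr, mulNmx, mulmxN)
    !(mul_delta, eqxx, negbTE ab, negbTE ba) !(mulr1n, mulr0n)
    !(oppr0, addr0, add0r, opprD, opprK).
have EJ : E *m J = J by rewrite /E /J !(mulmxDl, mulmxDr, mulNmx, mulmxN)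
    !(mul_delta, eqxx, negbTE ab, negbTE ba) !(mulr1n, mulr0n)
    !(oppr0, addr0, add0r, opprD, opprK).
have JE : J *m E = J by rewrite /E /J !(mulmxDl, mulmxDr, mulNmx, mulmxN)
    !(mul_delta, eqxx, negbTE ab, negbTE ba) !(mulr1n, mulr0n)
    !(oppr0, addr0, add0r, opprD, opprK) [LHS]addrC.
have JJ : J *m J = - E by rewrite /E /J !(mulmxDl, mulmxDr, mulNmx, mulmxN)
    !(mul_delta, eqxx, negbTE ab, negbTE ba) !(mulr1n, mulr0n)
    !(oppr0, addr0, add0r, opprD, opprK).
have ET : E^T = E by rewrite /E linearD /= !trmx_delta.
have JT : J^T = - J by rewrite /J linearB /= !trmx_delta opprB.
have trE : \tr (E *m B) = B a a + B b b.
  by rewrite mulmxDl mxtraceD !trace_delta_mul.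
have trJ : \tr (J *m B) = B b a - B a b.
  by rewrite mulmxBl linearB /= !trace_delta_mul.
(* Only the relations just collected are used from here on, so [E] and [J] become abstract. *)
move: (E) (J) EE EJ JE JJ ET JT trE trJ => {}E {}J EE EJ JE JJ ET JT trE trJ.
suff : B a b - B b a = 0 by move/subr0_eq.
apply: (@linear_coef_eq0 _ _ (B a a + B b b)) => t.
have t1 : 0 < 1 + t ^+ 2 by rewrite ltr_pwDl// sqr_ge0.
(* [1 + c] and [s] are the cosine and sine of the angle [2 arctan t]. *)
pose c := - (2 * t ^+ 2) / (1 + t ^+ 2).
pose s := 2 * t / (1 + t ^+ 2).
(* This is [(1 + c)^2 + s^2 = 1]; the left side is the coefficient of [E] in the Gram matrix of the
   rotation. *)
have cs : 2 * c + c ^+ 2 + s ^+ 2 = 0.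
  by rewrite /c /s; field; rewrite gt_eqF.
have /maxB : (1%:M + c *: E + s *: J)^T *m (1%:M + c *: E + s *: J) = 1%:M.
  rewrite !linearD /= !linearZ /= trmx1 ET JT.
  rewrite !(mulmxDl, mulmxDr, mulNmx, mulmxN, mul1mx, mulmx1, =^~ scalemxAl,
    =^~ scalemxAr) EE EJ JE JJ.
  transitivity (1%:M + (2 * c + c ^+ 2 + s ^+ 2) *: E).
    by apply/matrixP => i j; rewrite !mxE; ring.
  by rewrite cs scale0r addr0.
rewrite !mulmxDl mul1mx -!scalemxAl !mxtraceD !mxtraceZ trE trJ => h.
have {}h : 0 <= - (c * (B a a + B b b) + s * (B b a - B a b)) by lra.
(* Clearing the denominator leaves twice the polynomial in [t] required by [linear_coef_eq0]. *)
have := mulr_ge0 (ltW t1) h.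
have -> : (1 + t ^+ 2) * - (c * (B a a + B b b) + s * (B b a - B a b)) =
   2 * (t * (B a b - B b a) + t ^+ 2 * (B a a + B b b)).
  by rewrite /c /s; field; rewrite gt_eqF.
by rewrite pmulr_rge0.
Qed.

(** For orthogonal [U] the matrix [U^T *m X] stays on the manifold, so [B = M *m X^T] meets the
    preceding maximality condition and is symmetric. Multiplying by [X] on the right gives
    [M = X *m (M^T *m X)], and then by [X^T] on the left the first conclusion. *)
Lemma stiefel_stationary m n (X M : 'M[R]_(m, n)) : stiefel X ->
  (forall Y, stiefel Y -> \tr (M *m Y^T) <= \tr (M *m X^T)) ->
  X^T *m M = M^T *m X /\ M = X *m (X^T *m M).
Proof.
move=> XX maxM.
have sym : X *m M^T = M *m X^T.
  rewrite -[RHS]orthogonal_trace_max_sym ?trmx_mul ?trmxK// => U UU.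
  have : stiefel (U^T *m X).
    rewrite /stiefel /= trmx_mul trmxK mulmxA -(mulmxA _ U) (mulmx1C UU).
    by rewrite mulmx1.
  by move/maxM; rewrite trmx_mul trmxK [\tr (U *m _)]mxtrace_mulC mulmxA.
have MX : M = X *m (M^T *m X).
  by rewrite mulmxA sym -mulmxA XX mulmx1.
have XM : X^T *m M = M^T *m X by rewrite {1}MX mulmxA XX mul1mx.
by rewrite XM.
Qed.

Lemma sub_gramE m n (A B : 'M[R]_(m, n)) :
  \tr ((A - B) *m (A - B)^T) =
  \tr (A *m A^T) - 2 * \tr (A *m B^T) + \tr (B *m B^T).
Proof.
rewrite linearB /= mulmxBl !mulmxBr !linearB /=.
have -> : \tr (B *m A^T) = \tr (A *m B^T).
  by rewrite -mxtrace_tr trmx_mul trmxK.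
ring.
Qed.

(** Quadratic terms are constant on the Stiefel manifold, both in the fit and in the proximal term,
    so each member of the stack maximizes a linear form. *)
Lemma argmin_factor_stationary m n d N (X : mx_stack R m n N)
    (P : 'I_N -> 'M[R]_(m, d)) (Q : 'I_N -> 'M[R]_(n, d)) (del al : R) :
  0 < del ->
  argmin (@stiefel_stack R N m n) (fun Y =>
    del * (2^-1 * \sum_j \tr ((P j - mxmember Y j *m Q j) *m
                              (P j - mxmember Y j *m Q j)^T))
    + al / 2 * frob_norm (Y - X) ^+ 2) X ->
  factor_stationary X P Q.
Proof.
move=> del0 [hX minX].
suff H j : let H := (mxmember X j *m Q j - P j) *m (Q j)^T in
    (1%:M - mxmember X j *m (mxmember X j)^T) *m H = 0 /\
    H^T *m mxmember X j - (mxmember X j)^T *m H = 0.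
  by split => // j; have [] := H j.
(* [M] collects the linear terms in the factor: the first summand from the fit, the second from the
   proximal term. *)
pose M := del *: (P j *m (Q j)^T) + al *: mxmember X j.
have /(stiefel_stationary (hX j)) : forall Y, stiefel Y ->
    \tr (M *m Y^T) <= \tr (M *m (mxmember X j)^T).
  move=> Y hY.
  (* The competitor differs from [X] in member [j] only, so all other summands cancel. *)
  pose X' : mx_stack R m n N :=
    [ffun q => if q.2 == j then Y q.1.1 q.1.2 else X q].
  have X'j : mxmember X' j = Y by apply/matrixP => i k; rewrite mxE ffunE eqxx.
  have X'k k : k != j -> mxmember X' k = mxmember X k.
    by move=> kj; apply/matrixP => i l; rewrite !mxE ffunE (negbTE kj).
  have hX' : stiefel_stack X'.
    by move=> k; case: (eqVneq k j) => [->|/X'k ->//]; rewrite X'j.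
  have := minX _ hX'; rewrite subrr frob_norm0 expr0n /= mulr0 addr0.
  have -> : frob_norm (X' - X) ^+ 2 =
      \tr ((Y - mxmember X j) *m (Y - mxmember X j)^T).
    rewrite frob_sqE inner_mxmember (bigD1 j)//= big1 => [|k kj].
      by rewrite mxmemberB X'j addr0.
    by rewrite mxmemberB (X'k _ kj) subrr mul0mx mxtrace0.
  rewrite (bigD1 j)//= [in X in _ <= X](bigD1 j)//= X'j.
  rewrite [X in _ <= _ * (_ * (_ + X)) + _](eq_bigr (fun k =>
     \tr ((P k - mxmember X k *m Q k) *m (P k - mxmember X k *m Q k)^T)));
    last by move=> k kj; rewrite X'k.
  rewrite !sub_gramE.
  have sq (A : 'M[R]_(m, n)) : stiefel A ->
      \tr ((A *m Q j) *m (A *m Q j)^T) = \tr (Q j *m (Q j)^T).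
    by move=> AA; rewrite trmx_mul mxtrace_mulC !mulmxA -(mulmxA (Q j)^T) AA
      mulmx1 mxtrace_mulC.
  have sq1 (A : 'M[R]_(m, n)) : stiefel A ->
      \tr (A *m A^T) = \tr (1%:M : 'M[R]_n).
    by move=> AA; rewrite mxtrace_mulC AA.
  rewrite !sq// !sq1//.
  have trM (A : 'M[R]_(m, n)) : \tr (M *m A^T) =
      del * \tr (P j *m (A *m Q j)^T) + al * \tr (A *m (mxmember X j)^T).
    rewrite mulmxDl -!scalemxAl mxtraceD !mxtraceZ trmx_mul mulmxA.
    by rewrite -(mxtrace_tr (A *m _)) trmx_mul trmxK.
  by rewrite !trM sq1//; lra.
move=> [sym MX]; set A := mxmember X j in M sym MX *.
have AA : A^T *m A = 1%:M by exact: hX.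
(* The gradient is [A *m K - M] with [K] symmetric. Both terms satisfy the two linear conditions,
   hence so does their difference. *)
have HE : del *: ((A *m Q j - P j) *m (Q j)^T) =
    A *m (del *: (Q j *m (Q j)^T) + al%:M) - M.
  rewrite /M mulmxBl mulmxDr scalerBr -scalemxAr mul_mx_scalar mulmxA.
  by rewrite opprD addrACA [al *: A - _]addrN addr0.
set H := (A *m Q j - P j) *m (Q j)^T in HE *.
set K := del *: _ + _ in HE.
have KT : K^T = K.
  by rewrite /K linearD linearZ /= trmx_mul trmxK tr_scalar_mx.
have [H1 H2] : (1%:M - A *m A^T) *m (del *: H) = 0 /\
    (del *: H)^T *m A - A^T *m (del *: H) = 0.
  rewrite HE; split.
    rewrite mulmxBl mul1mx mulmxBr -!(mulmxA A) -MX (mulmxA A^T A) AA mul1mx.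
    by rewrite subrr.
  rewrite linearB /= trmx_mul KT mulmxBl mulmxBr -mulmxA AA mulmx1.
  by rewrite mulmxA AA mul1mx sym subrr.
have delN0 : del != 0 by rewrite gt_eqF.
split; apply: (scalerI delN0); rewrite scaler0.
  by rewrite scalemxAr.
by rewrite scalerBr scalemxAl scalemxAr -linearZ.
Qed.
End Stiefel.

(** * Continuity of the objective along convergent sequences *)

Section Convergence.
Context {R : realType}.

Lemma cvgn_sum (J : finType) (F : J -> nat -> R) (l : J -> R) :
  (forall j, F j k @[k --> \oo] --> l j) ->
  \sum_j F j k @[k --> \oo] --> \sum_j l j.
Proof. by move=> H; apply: cvg_big => //; exact: add_continuous. Qed.

(** Norm convergence is traded for this form, to which the limit laws for real sequences apply
    directly. *)
Definition entrywise_cvg (I : finType) (xs : nat -> {ffun I -> R})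
    (x : {ffun I -> R}) :=
  forall i, xs k i @[k --> \oo] --> x i.

(** Differentiability gives continuity at a positive limit. The limit 0, which occurs when a column
    of [S] tends to zero, is settled by monotonicity of the power. *)
Lemma cvg_powR (u : nat -> R) (l r : R) : 0 < r -> (forall k, 0 <= u k) ->
  u k @[k --> \oo] --> l -> u k `^ r @[k --> \oo] --> l `^ r.
Proof.
move=> r0 u0 ul.
have : 0 <= l by apply: (cvgr_to_ge ul); near=> k.
rewrite le_eqVlt => /orP[/eqP l0|l0].
  rewrite -l0 powR0 ?gt_eqF//; apply/cvgrPdist_lt => e e0.
  (* The threshold is chosen so that its power [r] is exactly [e]. *)
  have d0 : 0 < e `^ r^-1 by rewrite powR_gt0.
  rewrite -l0 in ul; have /cvgrPdist_lt/(_ _ d0) := ul.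
  apply: filterS => k; rewrite !sub0r !normrN !ger0_norm ?powR_ge0// => h.
  have := gt0_ltr_powR r0 (u0 k) (powR_ge0 _ _) h.
  by rewrite -powRrM mulVf ?gt_eqF// powRr1// ltW.
have cont : {for l, continuous (fun a : R => a `^ r)}.
  apply: differentiable_continuous; apply/derivable1_diffP.
  by apply: derivable_powR; rewrite in_itv/= andbT.
exact: cvg_comp ul cont.
Unshelve. all: by end_near. Qed.

Section Euclidean.
Context {I : finType}.
Implicit Types (x y : {ffun I -> R}) (xs ys : nat -> {ffun I -> R}).

(** Each entry is bounded by the Frobenius norm. Later this carries limits from an iterate to its
    successor. *)
Lemma frob_cvg0_entrywise xs ys x :
  frob_norm (ys k - xs k) @[k --> \oo] --> (0 : R) ->
  entrywise_cvg xs x -> entrywise_cvg ys x.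
Proof.
move=> H xsx i; apply: cvg_sub0 (xsx i).
apply/cvgrPdist_lt => e e0; move/cvgrPdist_lt : H => /(_ _ e0).
apply: filterS => k; rewrite !sub0r !normrN ger0_norm ?frob_norm_ge0//.
by apply: le_lt_trans; have := le_entry_frob (ys k - xs k) i; rewrite !ffunE.
Qed.

Lemma tends_to_entrywise xs x : tends_to xs x -> entrywise_cvg xs x.
Proof.
by move=> H; apply: (@frob_cvg0_entrywise (fun=> x)) => // i; apply: cvg_cst.
Qed.

Lemma tends_to_cst x : tends_to (fun=> x) x.
Proof. by rewrite /tends_to subrr frob_norm0; apply: cvg_cst. Qed.

Lemma frechet_subset_subdiff (f : {ffun I -> R} -> \bar R) x u :
  frechet_subdiff f x u -> subdiff f x u.
Proof.
move=> fxu; split; first by case: fxu.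
exists (fun=> x), (fun=> u); split => //; [|exact: cvg_cst|];
  exact: tends_to_cst.
Qed.

Lemma entrywise_cvgD xs ys x y : entrywise_cvg xs x -> entrywise_cvg ys y ->
  entrywise_cvg (fun k => xs k + ys k) (x + y).
Proof.
move=> xsx ysy i; rewrite ffunE.
by under eq_fun do rewrite ffunE; apply: cvgD.
Qed.

Lemma entrywise_cvgB xs ys x y : entrywise_cvg xs x -> entrywise_cvg ys y ->
  entrywise_cvg (fun k => xs k - ys k) (x - y).
Proof.
move=> xsx ysy i; rewrite !ffunE.
by under eq_fun do rewrite !ffunE; apply: cvgB.
Qed.

Lemma entrywise_cvg_cst x : entrywise_cvg (fun=> x) x.
Proof. by move=> i; apply: cvg_cst. Qed.

Lemma cvg_inner xs ys x y : entrywise_cvg xs x -> entrywise_cvg ys y ->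
  inner (xs k) (ys k) @[k --> \oo] --> inner x y.
Proof. by move=> xsx ysy; apply: cvgn_sum => i; apply: cvgM. Qed.

Lemma cvg_frob_sq xs x : entrywise_cvg xs x ->
  frob_norm (xs k) ^+ 2 @[k --> \oo] --> frob_norm x ^+ 2.
Proof.
move=> xsx; rewrite frob_sqE.
by under eq_fun do rewrite frob_sqE; apply: cvg_inner.
Qed.

(** An adjoint makes each coordinate of [A] the inner product with a fixed vector [At d], hence
    continuous. *)
Lemma entrywise_cvg_adjoint (J : finType) (A : {ffun I -> R} -> {ffun J -> R})
    (At : {ffun J -> R} -> {ffun I -> R}) xs x :
  is_adjoint A At -> entrywise_cvg xs x ->
  entrywise_cvg (fun k => A (xs k)) (A x).
Proof.
move=> hA xsx j; pose d : {ffun J -> R} := [ffun i => (i == j)%:R].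
have Aj z : A z j = inner z (At d).
  rewrite -hA /inner (bigD1 j)//= big1 ?addr0 => [|i ij].
    by rewrite ffunE eqxx mulr1.
  by rewrite ffunE (negbTE ij) mulr0.
rewrite Aj; under eq_fun do rewrite Aj.
by apply: (cvg_inner xsx) => i; exact: cvg_cst.
Qed.

End Euclidean.

Section Tucker.
Context {m1 m2 m3 n1 n2 n3 N : nat}.

(** The entries are polynomials in those of the blocks, which makes continuity immediate. *)
Lemma tuckerE (X1 : mx_stack R m1 n1 N) (X2 : mx_stack R m2 n2 N)
    (X3 : mx_stack R m3 n3 N) (G : tensor_stack R n1 n2 n3 N) i1 i2 i3 j :
  tucker X1 X2 X3 G (i1, i2, i3, j) =
  \sum_c X3 (i3, c, j) * \sum_b X2 (i2, b, j) *
    \sum_a X1 (i1, a, j) * G (a, b, c, j).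
Proof.
rewrite ffunE /= mode_prod3E; apply: eq_bigr => c _; rewrite mxE; congr (_ * _).
rewrite mode_prod2E; apply: eq_bigr => b _; rewrite mxE; congr (_ * _).
by rewrite mode_prod1E; apply: eq_bigr => a _; rewrite mxE ffunE.
Qed.

Lemma entrywise_cvg_tucker (X1s : nat -> mx_stack R m1 n1 N) X1
    (X2s : nat -> mx_stack R m2 n2 N) X2 (X3s : nat -> mx_stack R m3 n3 N) X3
    (Gs : nat -> tensor_stack R n1 n2 n3 N) G :
  entrywise_cvg X1s X1 -> entrywise_cvg X2s X2 -> entrywise_cvg X3s X3 ->
  entrywise_cvg Gs G ->
  entrywise_cvg (fun k => tucker (X1s k) (X2s k) (X3s k) (Gs k))
    (tucker X1 X2 X3 G).
Proof.
move=> h1 h2 h3 hG [[[i1 i2] i3] j]; rewrite tuckerE.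
under eq_fun do rewrite tuckerE.
apply: cvgn_sum => c; apply: cvgM => //; apply: cvgn_sum => b.
by apply: cvgM => //; apply: cvgn_sum => a; apply: cvgM.
Qed.

Lemma cvg_psi (w : 'I_N -> R) (Gs : nat -> tensor_stack R n1 n2 n3 N) G :
  entrywise_cvg Gs G -> psi w (Gs k) @[k --> \oo] --> psi w G.
Proof.
move=> h; apply: cvgn_sum => j; apply: cvgM; first exact: cvg_cst.
apply: cvgn_sum => t; rewrite ffunE.
by under eq_fun do rewrite ffunE; apply: cvg_norm.
Qed.

(** The Gram entries are polynomial in [Xs k] and constant in [k], so the limit inherits their
    values. *)
Lemma closed_stiefel_stack m n (Xs : nat -> mx_stack R m n N) X :
  (forall k, stiefel_stack (Xs k)) -> entrywise_cvg Xs X -> stiefel_stack X.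
Proof.
move=> hXs XsX j; apply/matrixP => a b.
have E (Y : mx_stack R m n N) : ((mxmember Y j)^T *m mxmember Y j) a b =
    \sum_i Y (i, a, j) * Y (i, b, j).
  by rewrite mxE; apply: eq_bigr => i _; rewrite !mxE.
rewrite E; have : \sum_i Xs k (i, a, j) * Xs k (i, b, j) @[k --> \oo] -->
    \sum_i X (i, a, j) * X (i, b, j).
  by apply: cvgn_sum => i; apply: cvgM.
have -> : (fun k => \sum_i Xs k (i, a, j) * Xs k (i, b, j)) =
    (fun=> (1%:M : 'M[R]_n) a b).
  by apply/funext => k; rewrite -E hXs.
by move=> /cvg_lim <-//; rewrite lim_cst.
Qed.

End Tucker.

Section Objective.
Context {I1 I2 I3 m1 m2 m3 n1 n2 n3 N : nat}.
Variables (D : tensor R I1 I2 I3) (p gamma delta : R) (w : 'I_N -> R).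
Variables (Rop : {linear tensor R I1 I2 I3 -> tensor_stack R m1 m2 m3 N})
          (RopT : tensor_stack R m1 m2 m3 N -> tensor R I1 I2 I3).
Hypothesis RopTP : is_adjoint Rop RopT.
Hypothesis p_gt0 : 0 < p.

Lemma cvg_phi (Ss : nat -> tensor R I1 I2 I3) S :
  entrywise_cvg Ss S -> phi p (Ss k) @[k --> \oo] --> phi p S.
Proof.
move=> h; apply: cvgn_sum => i3; apply: cvgn_sum => i2.
apply: cvg_powR; first by rewrite divr_gt0.
  by move=> k; apply: sumr_ge0 => i _; exact: sqr_ge0.
by apply: cvgn_sum => i1; rewrite expr2; apply: cvgM.
Qed.

Lemma cvg_Phi (Ss Ls : nat -> tensor R I1 I2 I3) S L
    (X1s : nat -> mx_stack R m1 n1 N) X1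
    (X2s : nat -> mx_stack R m2 n2 N) X2 (X3s : nat -> mx_stack R m3 n3 N) X3
    (Gs : nat -> tensor_stack R n1 n2 n3 N) G :
  entrywise_cvg Ss S ->
  entrywise_cvg X1s X1 -> entrywise_cvg X2s X2 -> entrywise_cvg X3s X3 ->
  entrywise_cvg Gs G -> entrywise_cvg Ls L ->
  Phi D p gamma delta w Rop (Ss k) (X1s k) (X2s k) (X3s k) (Gs k) (Ls k)
    @[k --> \oo] --> Phi D p gamma delta w Rop S X1 X2 X3 G L.
Proof.
move=> hS h1 h2 h3 hG hL; apply: cvgD; [apply: cvgD; [apply: cvgD|]|].
- apply: cvgM; [exact: cvg_cst|apply: cvg_frob_sq].
  apply: entrywise_cvgB; last exact: entrywise_cvg_cst.
  exact: entrywise_cvgD.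
- by apply: cvgM; [exact: cvg_cst|exact: cvg_phi].
- exact: cvg_psi.
- apply: cvgM; [exact: cvg_cst|apply: cvgM; first exact: cvg_cst].
  apply: cvg_frob_sq; apply: entrywise_cvgB.
    exact: (entrywise_cvg_adjoint RopTP).
  exact: entrywise_cvg_tucker.
Qed.

(** [xs] and [ys] are kept apart from the blocks so that one statement serves every proximal
    subproblem, at a fixed competitor and along the minimizers. *)
Lemma cvg_prox_Phi (I : finType) (a : R) (xs ys : nat -> {ffun I -> R}) x y
    (Ss Ls : nat -> tensor R I1 I2 I3) S L
    (X1s : nat -> mx_stack R m1 n1 N) X1
    (X2s : nat -> mx_stack R m2 n2 N) X2 (X3s : nat -> mx_stack R m3 n3 N) X3
    (Gs : nat -> tensor_stack R n1 n2 n3 N) G :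
  entrywise_cvg Ss S ->
  entrywise_cvg X1s X1 -> entrywise_cvg X2s X2 -> entrywise_cvg X3s X3 ->
  entrywise_cvg Gs G -> entrywise_cvg Ls L ->
  entrywise_cvg xs x -> entrywise_cvg ys y ->
  Phi D p gamma delta w Rop (Ss k) (X1s k) (X2s k) (X3s k) (Gs k) (Ls k)
      + a / 2 * frob_norm (xs k - ys k) ^+ 2 @[k --> \oo] -->
  Phi D p gamma delta w Rop S X1 X2 X3 G L + a / 2 * frob_norm (x - y) ^+ 2.
Proof.
move=> hS h1 h2 h3 hG hL hx hy; apply: cvgD; first exact: cvg_Phi.
apply: cvgM; first exact: cvg_cst.
exact: cvg_frob_sq (entrywise_cvgB hx hy).
Qed.

End Objective.
End Convergence.

(** * Limits of minimizers and of decreasing sequences *)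

Section Limits.
Context {R : realType}.

(** The competitor stays fixed while [k] grows, so each inequality passes to the limit separately
    and pointwise convergence is enough away from the minimizers. *)
Lemma argmin_cvg (T : Type) (A : set T) (F : nat -> T -> R) (f : T -> R)
    (xs : nat -> T) x :
  (forall k, argmin A (F k) (xs k)) -> A x ->
  (forall y, F k y @[k --> \oo] --> f y) ->
  F k (xs k) @[k --> \oo] --> f x -> argmin A f x.
Proof.
move=> minF Ax Ff Fx; split => // y Ay.
by apply: (ler_cvg_to Fx (Ff y)); near=> k; apply: (minF k).2.
Unshelve. all: by end_near. Qed.

Lemma cvg0_of_sq_le (c : R) (a e : nat -> R) : 0 < c ->
  (forall k, 0 <= a k) -> (forall k, c * a k ^+ 2 <= e k) ->
  e k @[k --> \oo] --> (0 : R) -> a k @[k --> \oo] --> (0 : R).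
Proof.
move=> c0 a0 ae /cvgrPdist_lt ecvg; apply/cvgrPdist_lt => d d0.
have cd : 0 < c * d ^+ 2 by rewrite mulr_gt0// exprn_gt0.
apply: filterS (ecvg _ cd) => k; rewrite !sub0r !normrN => ek.
rewrite ger0_norm// -(@ltr_pXn2r _ 2) ?nnegrE ?(ltW d0)//.
rewrite -(ltr_pM2l c0) (le_lt_trans (ae k))//.
exact: le_lt_trans (ler_norm _) ek.
Qed.

(** A nonincreasing sequence bounded below converges, and consecutive terms share its limit. *)
Lemma cvg_decrement (u : nat -> R) :
  (forall k, u k.+1 <= u k) -> (forall k, 0 <= u k) ->
  u k - u k.+1 @[k --> \oo] --> (0 : R).
Proof.
move=> u_dec u_ge0.
have cvg_u : cvgn u.
  apply: nonincreasing_is_cvgn; first exact/nonincreasing_seqP.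
  by exists 0 => _ [k _ <-]; apply: u_ge0.
rewrite -(subrr (limn u)); apply: cvgB => //.
by rewrite (cvg_shiftS u).
Qed.

Lemma homo_ltn_cvgny (s : nat -> nat) :
  {homo s : k l / (k < l)%N} -> s k @[k --> \oo] --> \oo.
Proof.
move=> hs; have ks k : (k <= s k)%N.
  by elim: k => // k /leq_ltn_trans; apply; apply: hs.
move=> A [n _ nA]; exists n => // k /= nk.
by apply: nA; apply: leq_trans nk (ks k).
Qed.

End Limits.

(** * Descent and limits of the P-BCD iteration *)

Section PBCD.
Context {R : realType} {I1 I2 I3 m1 m2 m3 n1 n2 n3 N : nat}.
Variables (D : tensor R I1 I2 I3) (p gamma delta : R) (w : 'I_N -> R).
Variables (Rop : {linear tensor R I1 I2 I3 -> tensor_stack R m1 m2 m3 N})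
          (RopT : tensor_stack R m1 m2 m3 N -> tensor R I1 I2 I3)
          (W : tensor R I1 I2 I3).
Hypotheses (p_gt0 : 0 < p) (gamma_gt0 : 0 < gamma) (delta_gt0 : 0 < delta)
  (w_gt0 : forall j, 0 < w j) (RopTP : is_adjoint Rop RopT)
  (RopTK : forall L : tensor R I1 I2 I3, RopT (Rop L) = hadamard W L).
Variables (alphaS alphaX alphaG : R).
Hypotheses (alphaS_gt0 : 0 < alphaS) (alphaX_gt0 : 0 < alphaX)
  (alphaG_gt0 : 0 < alphaG).

Local Notation Z := (iterate R I1 I2 I3 m1 m2 m3 n1 n2 n3 N).
Local Notation F := (Phi D p gamma delta w Rop).
Local Notation step := (pbcd_step D p gamma delta w Rop alphaS alphaX alphaG).

Definition feasible (z : Z) : Prop :=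
  [/\ stiefel_stack (ptX1 z), stiefel_stack (ptX2 z) & stiefel_stack (ptX3 z)].

Definition objective (z : Z) : R :=
  F (ptS z) (ptX1 z) (ptX2 z) (ptX3 z) (ptG z) (ptL z).

Lemma objective_ge0 z : 0 <= objective z.
Proof.
rewrite /objective /Phi /Hfun !addr_ge0//.
- by rewrite mulr_ge0// sqr_ge0.
- rewrite mulr_ge0 ?(ltW gamma_gt0)//; apply: sumr_ge0 => i _.
  by apply: sumr_ge0 => j _; apply: powR_ge0.
- apply: sumr_ge0 => j _; rewrite mulr_ge0 ?(ltW (w_gt0 j))//.
  exact: sumr_ge0.
- by rewrite mulr_ge0 ?(ltW delta_gt0)// mulr_ge0// sqr_ge0.
Qed.

Lemma prox_self (I : finType) (a : R) (x : {ffun I -> R}) :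
  a * frob_norm (x - x) ^+ 2 = 0.
Proof. by rewrite subrr frob_norm0 expr0n mulr0. Qed.

Lemma stepP z z' : step z z' <->
  [/\ argmin setT (fun Y => F Y (ptX1 z) (ptX2 z) (ptX3 z) (ptG z) (ptL z)
        + alphaS / 2 * frob_norm (Y - ptS z) ^+ 2) (ptS z'),
      argmin (@stiefel_stack R N m1 n1) (fun Y =>
        F (ptS z') Y (ptX2 z) (ptX3 z) (ptG z) (ptL z)
        + alphaX / 2 * frob_norm (Y - ptX1 z) ^+ 2) (ptX1 z'),
      argmin (@stiefel_stack R N m2 n2) (fun Y =>
        F (ptS z') (ptX1 z') Y (ptX3 z) (ptG z) (ptL z)
        + alphaX / 2 * frob_norm (Y - ptX2 z) ^+ 2) (ptX2 z'),
      argmin (@stiefel_stack R N m3 n3) (fun Y =>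
        F (ptS z') (ptX1 z') (ptX2 z') Y (ptG z) (ptL z)
        + alphaX / 2 * frob_norm (Y - ptX3 z) ^+ 2) (ptX3 z')
    & argmin setT (fun Y =>
        F (ptS z') (ptX1 z') (ptX2 z') (ptX3 z') Y (ptL z)
        + alphaG / 2 * frob_norm (Y - ptG z) ^+ 2) (ptG z')
      /\ argmin setT (F (ptS z') (ptX1 z') (ptX2 z') (ptX3 z') (ptG z'))
          (ptL z')].
Proof. by case: z; case: z'. Qed.

Lemma step_feasible z z' : step z z' -> feasible z'.
Proof.
by move=> /stepP [_ [? _] [? _] [? _] _]; split.
Qed.

(** Each old block is an admissible competitor with zero proximal cost; the six resulting
    inequalities telescope. *)
Lemma step_descent z z' : feasible z -> step z z' ->
  objective z' + alphaS / 2 * frob_norm (ptS z' - ptS z) ^+ 2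
    + alphaX / 2 * frob_norm (ptX1 z' - ptX1 z) ^+ 2
    + alphaX / 2 * frob_norm (ptX2 z' - ptX2 z) ^+ 2
    + alphaX / 2 * frob_norm (ptX3 z' - ptX3 z) ^+ 2
    + alphaG / 2 * frob_norm (ptG z' - ptG z) ^+ 2 <= objective z.
Proof.
case: z z' => [S X1 X2 X3 G L] [S' X1' X2' X3' G' L'] [/= hX1 hX2 hX3].
rewrite /step /objective /=.
move=> [[_ /(_ S I) h] [_ /(_ X1 hX1) h1] [_ /(_ X2 hX2) h2]].
move=> [_ /(_ X3 hX3) h3].
move=> [[_ /(_ G I) hG] [_ /(_ L I) hL]].
move: h h1 h2 h3 hG hL; rewrite !prox_self.
(* [f0] to [f6] are the objective values after zero to six block updates. *)
move: (F S X1 X2 X3 G L) (F S' X1 X2 X3 G L) (F S' X1' X2 X3 G L)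
  (F S' X1' X2' X3 G L) (F S' X1' X2' X3' G L) (F S' X1' X2' X3' G' L)
  (F S' X1' X2' X3' G' L') => f0 f1 f2 f3 f4 f5 f6.
move: (alphaS / 2 * _) (alphaX / 2 * _) (alphaX / 2 * _) (alphaX / 2 * _)
  (alphaG / 2 * _) => a b c d e h h1 h2 h3 hG hL.
lra.
Qed.

Section Sequence.
Variable z : nat -> Z.
Hypothesis zP : pbcd_sequence D p gamma delta w Rop alphaS alphaX alphaG z.

Lemma pbcd_feasible k : feasible (z k).
Proof.
case: zP => h1 h2 h3 hz; case: k => [//|k].
exact: step_feasible (hz k).
Qed.

Definition decrease k := objective (z k) - objective (z k.+1).

Lemma decrease_ge k :
  alphaS / 2 * frob_norm (ptS (z k.+1) - ptS (z k)) ^+ 2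
    + alphaX / 2 * frob_norm (ptX1 (z k.+1) - ptX1 (z k)) ^+ 2
    + alphaX / 2 * frob_norm (ptX2 (z k.+1) - ptX2 (z k)) ^+ 2
    + alphaX / 2 * frob_norm (ptX3 (z k.+1) - ptX3 (z k)) ^+ 2
    + alphaG / 2 * frob_norm (ptG (z k.+1) - ptG (z k)) ^+ 2 <= decrease k.
Proof.
case: zP => _ _ _ /(_ k) /(step_descent (pbcd_feasible k)).
by rewrite /decrease lerBrDl !addrA.
Qed.

Lemma half_sq_ge0 (I : finType) (a : R) (x : {ffun I -> R}) :
  0 < a -> 0 <= a / 2 * frob_norm x ^+ 2.
Proof. by move=> a0; rewrite mulr_ge0 ?sqr_ge0// ltW// divr_gt0. Qed.

Lemma decrease_cvg0 : decrease k @[k --> \oo] --> (0 : R).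
Proof.
apply: (@cvg_decrement _ (objective \o z)) => k; last exact: objective_ge0.
rewrite -subr_ge0; apply: le_trans (decrease_ge k).
by rewrite !addr_ge0// half_sq_ge0.
Qed.

Lemma increments_cvg0 :
  [/\ frob_norm (ptS (z k.+1) - ptS (z k)) @[k --> \oo] --> (0 : R),
      frob_norm (ptX1 (z k.+1) - ptX1 (z k)) @[k --> \oo] --> (0 : R),
      frob_norm (ptX2 (z k.+1) - ptX2 (z k)) @[k --> \oo] --> (0 : R),
      frob_norm (ptX3 (z k.+1) - ptX3 (z k)) @[k --> \oo] --> (0 : R)
    & frob_norm (ptG (z k.+1) - ptG (z k)) @[k --> \oo] --> (0 : R)].
Proof.
have half (a : R) : 0 < a -> 0 < a / 2 by move=> a0; rewrite divr_gt0.
have le_sum (a b c d e x : R) :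
    0 <= a -> 0 <= b -> 0 <= c -> 0 <= d -> 0 <= e ->
    a + b + c + d + e <= x -> [/\ a <= x, b <= x, c <= x, d <= x & e <= x].
  by move=> *; split; lra.
have le_decrease k := le_sum _ _ _ _ _ _ (half_sq_ge0 _ alphaS_gt0)
  (half_sq_ge0 _ alphaX_gt0) (half_sq_ge0 _ alphaX_gt0)
  (half_sq_ge0 _ alphaX_gt0) (half_sq_ge0 _ alphaG_gt0) (decrease_ge k).
split; [apply: (cvg0_of_sq_le (half _ alphaS_gt0) _ _ decrease_cvg0)
  |apply: (cvg0_of_sq_le (half _ alphaX_gt0) _ _ decrease_cvg0)
  |apply: (cvg0_of_sq_le (half _ alphaX_gt0) _ _ decrease_cvg0)
  |apply: (cvg0_of_sq_le (half _ alphaX_gt0) _ _ decrease_cvg0)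
  |apply: (cvg0_of_sq_le (half _ alphaG_gt0) _ _ decrease_cvg0)] => k;
  by [exact: frob_norm_ge0|case: (le_decrease k)].
Qed.

Lemma pbcd_limit_step zb : accumulation_point z zb ->
  feasible zb /\ step zb zb.
Proof.
case=> s [hs [hS h1 h2 h3 [hG hL]]].
(* Dropping the first term of the subsequence makes every index [s k.+1] positive, so each iterate
   kept has a predecessor; the [L]-block relies on it. *)
have shift (I : finType) (xs : nat -> {ffun I -> R}) x :
    tends_to xs x -> entrywise_cvg (fun k => xs k.+1) x.
  by move=> /tends_to_entrywise xsx i; have := xsx i; rewrite -cvg_shiftS.
move: hS h1 h2 h3 hG hL => /shift hS /shift h1 /shift h2 /shift h3 /shift hG.
move=> /shift hL.
have sy : s k.+1 @[k --> \oo] --> \oo.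
  by apply: homo_ltn_cvgny => k l kl; apply: hs.
have next (I : finType) (f : Z -> {ffun I -> R}) :
    frob_norm (f (z k.+1) - f (z k)) @[k --> \oo] --> (0 : R) ->
    entrywise_cvg (fun k => f (z (s k.+1))) (f zb) ->
    entrywise_cvg (fun k => f (z (s k.+1).+1)) (f zb).
  move=> f0; apply: frob_cvg0_entrywise.
  exact: (cvg_comp (fun k => s k.+1) _ sy f0).
have [iS i1 i2 i3 iG] := increments_cvg0.
have hS' := next _ _ iS hS; have h1' := next _ _ i1 h1.
have h2' := next _ _ i2 h2; have h3' := next _ _ i3 h3.
have hG' := next _ _ iG hG.
have feas : feasible zb.
  split; [move: h1|move: h2|move: h3]; apply: closed_stiefel_stack => k /=;
    by case: (pbcd_feasible (s k.+1)).
split => //; apply/stepP; have [F1 F2 F3] := feas.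
have zstep k : step (z k) (z k.+1) by case: zP.
have cst (I : finType) (x : {ffun I -> R}) := @entrywise_cvg_cst R I x.
pose u k := z (s k.+1); pose v k := z (s k.+1).+1.
(* [u] runs through the subsequence and [v] through the successors; by vanishing increments their
   [S], [X_i] and [G] blocks have the same limits. *)
have uv k := (stepP (u k) (v k)).1 (zstep (s k.+1)).
split; last split.
(* The four goals, here and for the other blocks: minimality along the sequence, feasibility of the
   limit, convergence at a constant competitor [Y], convergence along the minimizers. *)
- apply: (@argmin_cvg _ _ _ (fun k Y =>
    F Y (ptX1 (u k)) (ptX2 (u k)) (ptX3 (u k)) (ptG (u k)) (ptL (u k))
    + alphaS / 2 * frob_norm (Y - ptS (u k)) ^+ 2) _ (ptS \o v)) => [k| |Y|].
  + by case: (uv k).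
  + by [].
  + by apply: (cvg_prox_Phi RopTP p_gt0 (xs := fun=> Y) (Ss := fun=> Y))
      => //; exact: cst.
  + exact: (cvg_prox_Phi RopTP p_gt0 (xs := ptS \o v) (Ss := ptS \o v)).
- apply: (@argmin_cvg _ _ _ (fun k Y =>
    F (ptS (v k)) Y (ptX2 (u k)) (ptX3 (u k)) (ptG (u k)) (ptL (u k))
    + alphaX / 2 * frob_norm (Y - ptX1 (u k)) ^+ 2) _ (ptX1 \o v)) => [k| |Y|].
  + by case: (uv k).
  + by [].
  + by apply: (cvg_prox_Phi RopTP p_gt0 (xs := fun=> Y) (Ss := ptS \o v)
      (X1s := fun=> Y)) => //; exact: cst.
  + exact: (cvg_prox_Phi RopTP p_gt0 (xs := ptX1 \o v) (Ss := ptS \o v)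
      (X1s := ptX1 \o v)).
- apply: (@argmin_cvg _ _ _ (fun k Y =>
    F (ptS (v k)) (ptX1 (v k)) Y (ptX3 (u k)) (ptG (u k)) (ptL (u k))
    + alphaX / 2 * frob_norm (Y - ptX2 (u k)) ^+ 2) _ (ptX2 \o v)) => [k| |Y|].
  + by case: (uv k).
  + by [].
  + by apply: (cvg_prox_Phi RopTP p_gt0 (xs := fun=> Y) (Ss := ptS \o v)
      (X1s := ptX1 \o v) (X2s := fun=> Y))
      => //; exact: cst.
  + exact: (cvg_prox_Phi RopTP p_gt0 (xs := ptX2 \o v) (Ss := ptS \o v)
      (X1s := ptX1 \o v) (X2s := ptX2 \o v)).
- apply: (@argmin_cvg _ _ _ (fun k Y =>
    F (ptS (v k)) (ptX1 (v k)) (ptX2 (v k)) Y (ptG (u k)) (ptL (u k))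
    + alphaX / 2 * frob_norm (Y - ptX3 (u k)) ^+ 2) _ (ptX3 \o v)) => [k| |Y|].
  + by case: (uv k).
  + by [].
  + by apply: (cvg_prox_Phi RopTP p_gt0 (xs := fun=> Y) (Ss := ptS \o v)
      (X1s := ptX1 \o v) (X2s := ptX2 \o v) (X3s := fun=> Y)) => //; exact: cst.
  + exact: (cvg_prox_Phi RopTP p_gt0 (xs := ptX3 \o v) (Ss := ptS \o v)
      (X1s := ptX1 \o v) (X2s := ptX2 \o v) (X3s := ptX3 \o v)).
- apply: (@argmin_cvg _ _ _ (fun k Y =>
    F (ptS (v k)) (ptX1 (v k)) (ptX2 (v k)) (ptX3 (v k)) Y (ptL (u k))
    + alphaG / 2 * frob_norm (Y - ptG (u k)) ^+ 2) _ (ptG \o v)) => [k| |Y|].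
  + by case: (uv k) => _ _ _ _ [].
  + by [].
  + by apply: (cvg_prox_Phi RopTP p_gt0 (xs := fun=> Y) (Ss := ptS \o v)
      (X1s := ptX1 \o v) (X2s := ptX2 \o v) (X3s := ptX3 \o v) (Gs := fun=> Y))
      => //; exact: cst.
  + exact: (cvg_prox_Phi RopTP p_gt0 (xs := ptG \o v) (Ss := ptS \o v)
      (X1s := ptX1 \o v) (X2s := ptX2 \o v) (X3s := ptX3 \o v)
      (Gs := ptG \o v)).
- (* The previous [L]-step was taken at the current values of all other blocks,
     so no bound on the increments of [L] is needed. *)
  have L_opt k : argmin setT (F (ptS (u k)) (ptX1 (u k)) (ptX2 (u k))
      (ptX3 (u k)) (ptG (u k))) (ptL (u k)).
    have : (0 < s k.+1)%N by apply: leq_ltn_trans (hs k k.+1 (ltnSn k)).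
    rewrite /u; case: (s k.+1) => // l _.
    by have /stepP [_ _ _ _ []] := zstep l.
  apply: (@argmin_cvg _ _ _ (fun k => F (ptS (u k)) (ptX1 (u k)) (ptX2 (u k))
      (ptX3 (u k)) (ptG (u k))) _ (ptL \o u)) => [//|//|Y|].
  + by apply: (cvg_Phi RopTP p_gt0 (Ls := fun=> Y)) => //; exact: cst.
  + exact: (cvg_Phi RopTP p_gt0 (Ls := ptL \o u)).
Qed.
End Sequence.

(** * Stationarity at fixed points of the iteration *)

Lemma argmin_addr_const (T : Type) (A : set T) (f g : T -> R) (c : R) x :
  (forall y, f y = g y + c) -> argmin A f x -> argmin A g x.
Proof.
by move=> fg [Ax minf]; split => // y /minf; rewrite !fg lerD2r.
Qed.

(** With mode 1 moved last, the fit becomes a matrix least-squares problem in [X1], the form treated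
    by [argmin_factor_stationary]. *)
Lemma HfunE_unfold1 (X1 : mx_stack R m1 n1 N) (X2 : mx_stack R m2 n2 N)
    (X3 : mx_stack R m3 n3 N) (G : tensor_stack R n1 n2 n3 N) L
    (P := fun j => unfold1 (tmember (Rop L) j))
    (Q := fun j =>
      unfold1 (tmember G j ×2 mxmember X2 j ×3 mxmember X3 j)) :
  Hfun Rop X1 X2 X3 G L = 2^-1 * \sum_j
    \tr ((P j - mxmember X1 j *m Q j) *m (P j - mxmember X1 j *m Q j)^T).
Proof.
rewrite /Hfun frob_sqE inner_tmember; congr (_ * _); apply: eq_bigr => j _.
by rewrite inner_unfold1 tmemberB unfold1B tmemberK mode_prod12C mode_prod13C
  fold1K.
Qed.

Lemma HfunE_unfold2 (X1 : mx_stack R m1 n1 N) (X2 : mx_stack R m2 n2 N)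
    (X3 : mx_stack R m3 n3 N) (G : tensor_stack R n1 n2 n3 N) L
    (P := fun j => unfold2 (tmember (Rop L) j))
    (Q := fun j =>
      unfold2 (tmember G j ×1 mxmember X1 j ×3 mxmember X3 j)) :
  Hfun Rop X1 X2 X3 G L = 2^-1 * \sum_j
    \tr ((P j - mxmember X2 j *m Q j) *m (P j - mxmember X2 j *m Q j)^T).
Proof.
rewrite /Hfun frob_sqE inner_tmember; congr (_ * _); apply: eq_bigr => j _.
by rewrite inner_unfold2 tmemberB unfold2B tmemberK mode_prod23C fold2K.
Qed.

Lemma HfunE_unfold3 (X1 : mx_stack R m1 n1 N) (X2 : mx_stack R m2 n2 N)
    (X3 : mx_stack R m3 n3 N) (G : tensor_stack R n1 n2 n3 N) L
    (P := fun j => unfold3 (tmember (Rop L) j))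
    (Q := fun j =>
      unfold3 (tmember G j ×1 mxmember X1 j ×2 mxmember X2 j)) :
  Hfun Rop X1 X2 X3 G L = 2^-1 * \sum_j
    \tr ((P j - mxmember X3 j *m Q j) *m (P j - mxmember X3 j *m Q j)^T).
Proof.
rewrite /Hfun frob_sqE inner_tmember; congr (_ * _); apply: eq_bigr => j _.
by rewrite inner_unfold3 tmemberB unfold3B tmemberK fold3K.
Qed.

Section FixedPoint.
Variables (S L : tensor R I1 I2 I3) (X1 : mx_stack R m1 n1 N)
  (X2 : mx_stack R m2 n2 N) (X3 : mx_stack R m3 n3 N)
  (G : tensor_stack R n1 n2 n3 N).
Hypotheses (hX1 : stiefel_stack X1) (hX2 : stiefel_stack X2)
  (hX3 : stiefel_stack X3).

Lemma stationary_S :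
  argmin setT (fun Y => F Y X1 X2 X3 G L
    + alphaS / 2 * frob_norm (Y - S) ^+ 2) S ->
  exists2 u, subdiff (EFin \o phi p) S u & 0 = L + S - D + gamma *: u.
Proof.
(* The stationarity equation itself forces this subgradient. *)
move=> [_ minS]; exists (- gamma^-1 *: (L + S - D)); last first.
  by rewrite scalerA mulrN mulfV ?gt_eqF// scaleN1r subrr.
apply: frechet_subset_subdiff.
(* The fit contributes [1 / 2] and the proximal term [alphaS / 2]; isolating [phi] divides both by
   [gamma]. *)
apply: (@quadratic_minorant_frechet_subdiff _ _ _ _ _
  ((1 + alphaS) / (2 * gamma))).
  by rewrite divr_ge0// ?mulr_ge0// ?(ltW gamma_gt0)// addr_ge0// ltW.
move=> Y; have := minS Y I; rewrite prox_self.
have res : L + Y - D = L + S - D + (Y - S).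
  by apply/ffunP => i; rewrite !ffunE; ring.
rewrite /Phi res (frob_sqD _ (Y - S)) innerZl.
move: (Hfun _ _ _ _ _ _) (psi _ _) (phi p Y) (phi p S) (inner _ _)
  (frob_norm (Y - S) ^+ 2) (frob_norm _ ^+ 2) => h ps py p0 ip d2 r2 minY.
rewrite -(ler_pM2l gamma_gt0).
have -> : gamma * (- gamma^-1 * ip - (1 + alphaS) / (2 * gamma) * d2) =
    - ip - (1 + alphaS) / 2 * d2 by field; rewrite gt_eqF.
lra.
Qed.

Lemma stationary_G (O := tstack (fun j => tmember (Rop L) j
    ×1 (mxmember X1 j)^T ×2 (mxmember X2 j)^T ×3 (mxmember X3 j)^T)) :
  argmin setT (fun Y => F S X1 X2 X3 Y L
    + alphaG / 2 * frob_norm (Y - G) ^+ 2) G ->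
  exists2 v, subdiff (EFin \o psi w) G v & 0 = delta *: (G - O) + v.
Proof.
have key (r2 h2 hY ps pG pY iO iG d2 : R) :
    2^-1 * r2 + gamma * ps + pG + delta * (2^-1 * h2) + 0 <=
      2^-1 * r2 + gamma * ps + pY + delta * (2^-1 * hY) + alphaG / 2 * d2 ->
    hY = h2 - 2 * (iO - iG) + d2 ->
    - (delta * (iG - iO)) - (delta + alphaG) / 2 * d2 <= pY - pG.
  by move=> + hYE; rewrite hYE => ?; lra.
move=> [_ minG]; exists (- (delta *: (G - O))); last by rewrite subrr.
apply: frechet_subset_subdiff.
(* [delta / 2] comes from the isometric expansion of the fit, [alphaG / 2] from the proximal
   term. *)
apply: (@quadratic_minorant_frechet_subdiff _ _ _ _ _ ((delta + alphaG) / 2)).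
  by rewrite divr_ge0// addr_ge0// ltW.
move=> Y; have minY := minG Y I; rewrite prox_self in minY.
have inner_grad : inner (- (delta *: (G - O))) (Y - G) =
    - (delta * (inner G (Y - G) - inner O (Y - G))).
  by rewrite innerNl innerZl (innerBl G O).
have Y_eq : Y = G + (Y - G) by rewrite addrC subrK.
have := frob_sq_tucker_residual (Rop L) G (Y - G) hX1 hX2 hX3.
rewrite -Y_eq inner_grad => fit.
exact: (key (frob_norm (L + S - D) ^+ 2) _ _ (phi p S) _ _ _ _ _ minY fit).
Qed.

Lemma stationary_L :
  argmin setT (F S X1 X2 X3 G) L ->
  0 = L + S - D + delta *: hadamard W L - delta *: RopT (tucker X1 X2 X3 G).
Proof.
move=> [_ minL]; set g := RHS; apply/esym/inner_eq0.
(* Moving [L] along the gradient [g] itself, the objective is quadratic in [t] with slope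
   [inner g g]; the other coefficient gathers the second-order terms. *)
apply: (@linear_coef_eq0 _ _
  (2^-1 * frob_norm g ^+ 2 + delta * (2^-1 * frob_norm (Rop g) ^+ 2))) => t.
have := minL (L + t *: g) I.
have res1 : L + t *: g + S - D = L + S - D + t *: g.
  by apply/ffunP => i; rewrite !ffunE; ring.
have res2 : Rop (L + t *: g) - tucker X1 X2 X3 G =
    Rop L - tucker X1 X2 X3 G + t *: Rop g.
  by rewrite linearD linearZ /= addrAC.
have frobZ (I : finType) (a : R) (x : {ffun I -> R}) :
    frob_norm (a *: x) ^+ 2 = a ^+ 2 * frob_norm x ^+ 2.
  by rewrite !frob_sqE innerZl innerZr; ring.
rewrite /Phi /Hfun res1 res2 !(frob_sqD _ (t *: _)) !frobZ !innerZr.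
(* The adjoint and [RopTK] rewrite the two directional derivatives as pairings with [g]. *)
have gg : inner g g = inner (L + S - D) g
    + delta * inner (Rop L - tucker X1 X2 X3 G) (Rop g).
  have -> : inner (Rop L - tucker X1 X2 X3 G) (Rop g) =
      inner (hadamard W L) g - inner (RopT (tucker X1 X2 X3 G)) g.
    rewrite innerDl innerNl !(innerC _ (Rop g)) !RopTP RopTK.
    by rewrite !(innerC g).
  have -> : inner g g = inner (L + S - D + delta *: hadamard W L
      - delta *: RopT (tucker X1 X2 X3 G)) g by [].
  rewrite (innerBl (L + S - D + _)) (innerDl (L + S - D)) !innerZl.
  by rewrite mulrBr addrA.
rewrite gg.
move: (psi w G) (phi p S) (inner _ g) (inner _ (Rop g)) (frob_norm g ^+ 2)
  (frob_norm (Rop g) ^+ 2) (frob_norm (L + S - D) ^+ 2) (frob_norm _ ^+ 2).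
move=> ps ph i1 i2 g2 rg2 r2 h2; lra.
Qed.

End FixedPoint.

Lemma step_fixed_stationary z : feasible z -> step z z ->
  stationary_point D p gamma delta w Rop RopT W z.
Proof.
case: z => S X1 X2 X3 G L [/= h1 h2 h3] [oS o1 o2 o3 [oG oL]].
split; [exact: stationary_S oS| |exact: stationary_G oG|exact: stationary_L oL].
(* [c] is the part of the objective independent of the factors, removed before applying the Stiefel
   result. *)
pose c := 2^-1 * frob_norm (L + S - D) ^+ 2 + gamma * phi p S + psi w G.
have PhiE X1' X2' X3' x :
    F S X1' X2' X3' G L + x = delta * Hfun Rop X1' X2' X3' G L + x + c.
  by rewrite /Phi -/c [c + _]addrC addrAC.
split; apply: (argmin_factor_stationary (del := delta) (al := alphaX)) => //.
- by apply: (argmin_addr_const (c := c) _ o1) => Y; rewrite -HfunE_unfold1.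
- by apply: (argmin_addr_const (c := c) _ o2) => Y; rewrite -HfunE_unfold2.
- by apply: (argmin_addr_const (c := c) _ o3) => Y; rewrite -HfunE_unfold3.
Qed.

End PBCD.

Theorem theorem4p5 (R : realType) (I1 I2 I3 m1 m2 m3 n1 n2 n3 N : nat)
  (hmn1 : (n1 <= m1)%N) (hmn2 : (n2 <= m2)%N) (hmn3 : (n3 <= m3)%N)
  (D : tensor R I1 I2 I3) (p gamma delta : R) (w : 'I_N -> R)
  (hp : 0 < p < 1) (hgamma : 0 < gamma) (hdelta : 0 < delta)
  (hw : forall j, 0 < w j)
  (Rop : {linear tensor R I1 I2 I3 -> tensor_stack R m1 m2 m3 N})
  (RopT : tensor_stack R m1 m2 m3 N -> tensor R I1 I2 I3)
  (W : tensor R I1 I2 I3)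
  (hRopT : is_adjoint Rop RopT)
  (hW : forall i, 0 < W i)
  (hRtR : forall L : tensor R I1 I2 I3, RopT (Rop L) = hadamard W L)
  (alphaS alphaX alphaG : R)
  (hS : 0 < alphaS) (hX : 0 < alphaX) (hG : 0 < alphaG)
  (Z : nat -> iterate R I1 I2 I3 m1 m2 m3 n1 n2 n3 N)
  (hZ : pbcd_sequence D p gamma delta w Rop alphaS alphaX alphaG Z)
  (Zb : iterate R I1 I2 I3 m1 m2 m3 n1 n2 n3 N)
  (hacc : accumulation_point Z Zb) :
  stationary_point D p gamma delta w Rop RopT W Zb.
Proof.
have [p_gt0 _] := andP hp.
have [feas fixed] := pbcd_limit_step p_gt0 hgamma hdelta hw hRopT hS hX hG hZ
  hacc.
exact: (step_fixed_stationary hgamma hdelta hRopT hRtR hS hG feas fixed).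
Qed.
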